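(* Every locally refining loop in the space $\mathcal{D}(n)$ of Delzant polytopes in $\mathbb{R}^n$ is null-homotopic in $\mathcal{D}(n)$.
   Context: A Delzant polytope in $\mathbb{R}^n$ is a full-dimensional polytope such that every vertex lies in exactly $n$ edges, all edge directions are rational, and at each vertex the $n$ primitive integer vectors along the edges form a basis of $\mathbb{Z}^n$. $\mathcal{D}(n)$ is the set of Delzant polytopes in $\mathbb{R}^n$ with the topology induced by the Hausdorff distance, equivalently by the symmetric difference distance $\delta^V(P,Q)=\mathrm{Vol}(P\setminus Q)+\mathrm{Vol}(Q\setminus P)$. The normal fan of a polytope $P$ consists of the cones $\{\alpha\in(\mathbb{R}^n)^*:\langle\alpha,p-q\rangle\ge 0\ \forall p\in F,q\in P\}$ for all nonempty faces $F$ of $P$. A complete fan $\Sigma'$ refines a complete fan $\Sigma$ if every cone of $\Sigma'$ is contained in some cone of $\Sigma$. A path (continuous map) $\gamma:[0,1]\to\mathcal{D}(n)$ is locally refining if for every $t_0\in[0,1]$ there is an $\epsilon>0$ such that for every $t\in[0,1]$ with $|t-t_0|\le\epsilon$ the normal fan of $\gamma(t)$ refines that of $\gamma(t_0)$. A loop is a path with $\gamma(0)=\gamma(1)$. *)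

(* Defs.v *)
From HB Require Import structures.
From mathcomp Require Import all_boot all_order all_algebra.
From mathcomp Require Import all_classical all_reals all_analysis.
From mathcomp Require Import ring.

Set Implicit Arguments.
Unset Strict Implicit.
Unset Printing Implicit Defensive.
Import Order.TTheory GRing.Theory Num.Theory.
Import numFieldNormedType.Exports.

Local Open Scope classical_set_scope.
Local Open Scope ring_scope.

(** Points of R^n are row vectors, linear forms on R^n are column vectors. *)

Section Polytopes.
Context {R : realType} {n : nat}.
Implicit Types (P E F : set 'rV[R]_n) (p q v : 'rV[R]_n) (a : 'cV[R]_n).

Definition pairing a p : R := (p *m a) 0 0.

(* The rows of [A] are the points whose convex hull is taken. *)
Definition convex_hull m (A : 'M[R]_(m, n)) : set 'rV[R]_n :=
  [set w *m A | w in
    [set w : 'rV[R]_m | (forall i, 0 <= w 0 i) /\ \sum_i w 0 i = 1]].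

Definition polytope P :=
  P !=set0 /\ exists m (A : 'M[R]_(m, n)), P = convex_hull A.

(* [V] is the linear direction of the affine hull of [F]. *)
Definition direction F (V : {vspace 'rV[R]_n}) :=
  (forall p q, F p -> F q -> p - q \in V) /\
  (forall W : {vspace 'rV[R]_n},
     (forall p q, F p -> F q -> p - q \in W) -> (V <= W)%VS).

(* The dimension of the affine hull; meaningful for nonempty [F] only. *)
Definition has_dim F (d : nat) := exists2 V, direction F V & \dim V = d.

(* Nonempty faces of [P], with [P] itself obtained for [a = 0]. *)
Definition face P F :=
  F !=set0 /\ exists a : 'cV[R]_n,
    F = [set p | P p /\ forall q, P q -> pairing a q <= pairing a p].

Definition vertex P v := face P [set v].

Definition edge P E := face P E /\ has_dim E 1.

Definition edges_at P v : set (set 'rV[R]_n) := [set E | edge P E /\ E v].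

Definition rational_direction E :=
  exists u : 'rV[rat]_n, direction E <[map_mx (ratr : rat -> R) u]>%VS.

Definition primitive (u : 'rV[int]_n) :=
  \big[gcdn/0%N]_(j < n) absz (u 0 j) = 1%N.

(* [u] points into [E] from the endpoint [v]. *)
Definition along v E (u : 'rV[int]_n) :=
  exists2 t : R, 0 < t & E (v + t *: map_mx intr u).

Definition primitive_edge_vectors P v : set 'rV[int]_n :=
  [set u | primitive u /\ exists2 E, edges_at P v E & along v E u].

(* The rows of [B] form a basis of the lattice Z^n. *)
Definition lattice_basis (B : 'M[int]_n) :=
  forall z : 'rV[int]_n, exists! c : 'rV[int]_n, z = c *m B.

Definition is_delzant P :=
  [/\ polytope P /\ has_dim P n,
      forall v, vertex P v -> (edges_at P v #= `I_n)%card,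
      forall E, edge P E -> rational_direction E &
      forall v, vertex P v -> exists2 B : 'M[int]_n,
        primitive_edge_vectors P v = [set row i B | i in [set: 'I_n]] &
        lattice_basis B].

Definition normal_cone P F : set 'cV[R]_n :=
  [set a | forall p q, F p -> P q -> 0 <= pairing a (p - q)].

Definition normal_fan P : set (set 'cV[R]_n) :=
  [set normal_cone P F | F in face P].

Definition refines (S' S : set (set 'cV[R]_n)) :=
  forall C', S' C' -> exists2 C, S C & C' `<=` C.

End Polytopes.

Section Hausdorff.
Context {R : realType} {n : nat}.
Implicit Types (P Q : set 'rV[R]_n) (p q : 'rV[R]_n).

(* The Euclidean distance; the norm that the library puts on matrices is the
   sup norm. *)
Definition euclidean_dist p q : R := Num.sqrt (\sum_i (p 0 i - q 0 i) ^+ 2).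

Definition dist_to_set p Q : \bar R :=
  ereal_inf [set (euclidean_dist p q)%:E | q in Q].

Definition hausdorff_dist P Q : \bar R :=
  Order.max (ereal_sup [set dist_to_set p Q | p in P])
            (ereal_sup [set dist_to_set q P | q in Q]).

Lemma euclidean_distC p q : euclidean_dist p q = euclidean_dist q p.
Proof.
congr Num.sqrt; apply: eq_bigr => i _.
by rewrite -[p 0 i - q 0 i]opprB sqrrN.
Qed.

Lemma euclidean_distxx p : euclidean_dist p p = 0.
Proof.
rewrite /euclidean_dist big1 ?sqrtr0 // => i _.
by rewrite subrr expr0n.
Qed.

Lemma sum_cauchy_schwarz (x y : 'I_n -> R) :
  (\sum_i x i * y i) ^+ 2 <= (\sum_i x i ^+ 2) * (\sum_i y i ^+ 2).
Proof.
set a := \sum_i x i ^+ 2; set b := \sum_i x i * y i.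
set c := \sum_i y i ^+ 2.
have a0 : 0 <= a by apply: sumr_ge0 => i _; exact: sqr_ge0.
have key s t : 0 <= s ^+ 2 * a - 2 * (s * t) * b + t ^+ 2 * c.
  suff -> : s ^+ 2 * a - 2 * (s * t) * b + t ^+ 2 * c =
            \sum_i (s * x i - t * y i) ^+ 2.
    by apply: sumr_ge0 => i _; exact: sqr_ge0.
  rewrite !mulr_sumr -sumrB -big_split /=; apply: eq_bigr => i _.
  by ring.
have [a_gt0|a_le0] := ltP 0 a.
  rewrite -subr_ge0 -(pmulr_rge0 _ a_gt0); have := key b a.
  by congr (0 <= _); ring.
have a_eq0 : a = 0 by apply/eqP; rewrite eq_le a_le0.
have x0 i : x i = 0.
  have /eqP := a_eq0; rewrite psumr_eq0 => [/allP/(_ i)|j _]; last exact: sqr_ge0.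
  by rewrite mem_index_enum sqrf_eq0 => /(_ isT)/eqP.
by rewrite a_eq0 mul0r /b big1 ?expr0n // => i _; rewrite x0 mul0r.
Qed.

Lemma euclidean_dist_triangle p q r :
  euclidean_dist p r <= euclidean_dist p q + euclidean_dist q r.
Proof.
rewrite /euclidean_dist.
set x := fun i => p 0 i - q 0 i; set y := fun i => q 0 i - r 0 i.
have x0 : 0 <= \sum_i x i ^+ 2 by apply: sumr_ge0 => i _; exact: sqr_ge0.
have y0 : 0 <= \sum_i y i ^+ 2 by apply: sumr_ge0 => i _; exact: sqr_ge0.
rewrite -[leRHS]ger0_norm ?addr_ge0 ?sqrtr_ge0// -sqrtr_sqr ler_wsqrtr//.
rewrite sqrrD !sqr_sqrtr// -sqrtrM//.
rewrite (_ : \sum_i _ = \sum_i x i ^+ 2 + (\sum_i x i * y i) *+ 2 +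
                        \sum_i y i ^+ 2).
  rewrite lerD2r lerD2l lerMn2r; apply: (le_trans (ler_norm _)).
  by rewrite -sqrtr_sqr ler_wsqrtr// sum_cauchy_schwarz.
rewrite -sumrMnl -!big_split /=; apply: eq_bigr => i _.
by rewrite -sqrrD /x /y addrA subrK.
Qed.

Lemma hausdorff_distC P Q : hausdorff_dist P Q = hausdorff_dist Q P.
Proof. exact: maxC. Qed.

Lemma hausdorff_dist_ltP P Q (e : R) : (0 < e)%R ->
  (hausdorff_dist P Q < e%:E)%E <->
  exists r : R, [/\ r < e,
    forall p, P p -> exists2 q, Q q & euclidean_dist p q <= r &
    forall q, Q q -> exists2 p, P p & euclidean_dist q p <= r].
Proof.
move=> e0.
have half (A B : set 'rV[R]_n) : (ereal_sup [set dist_to_set p B | p in A] < e%:E)%E <->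
    exists2 r : R, r < e &
      forall p, A p -> exists2 q, B q & euclidean_dist p q <= r.
  split=> [h|[r re h]]; last first.
    apply: (@le_lt_trans _ _ r%:E); last by rewrite lte_fin.
    apply: ge_ereal_sup => _ [p Ap <-]; have [q Bq pq] := h p Ap.
    apply: (@le_trans _ _ (euclidean_dist p q)%:E); last by rewrite lee_fin.
    by apply: ereal_inf_lbound; exists q.
  have [r re supr] : exists2 r : R, r < e &
      (ereal_sup [set dist_to_set p B | p in A] < r%:E)%E.
    move: h; case: (ereal_sup _) => [s| |] //= h.
      move: h; rewrite lte_fin => /midf_lt[h1 h2].
      by exists ((s + e) / 2); rewrite ?lte_fin.
    by exists 0; rewrite ?ltNyr.
  exists r => // p Ap.
  have /ereal_inf_lt[_ [q Bq <-]] : (dist_to_set p B < r%:E)%E.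
    by apply: le_lt_trans supr; apply: ereal_sup_ubound; exists p.
  by rewrite lte_fin => /ltW pq; exists q.
rewrite /hausdorff_dist gt_max; split.
  move=> /andP[/half[r1 r1e h1] /half[r2 r2e h2]].
  exists (Num.max r1 r2); split; first by rewrite gt_max r1e.
    by move=> p /h1[q Qq pq]; exists q => //; rewrite le_max pq.
  by move=> q /h2[p Pp qp]; exists p => //; rewrite le_max qp orbT.
by move=> [r [re h1 h2]]; apply/andP; split; apply/half; exists r.
Qed.

End Hausdorff.

Record delzant (R : realType) (n : nat) := Delzant {
  delzant_set :> set 'rV[R]_n;
  delzantP : is_delzant delzant_set }.

HB.instance Definition _ (R : realType) (n : nat) := gen_eqMixin (delzant R n).
HB.instance Definition _ (R : realType) (n : nat) :=
  gen_choiceMixin (delzant R n).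

Section DelzantSpace.
Context {R : realType} {n : nat}.
Implicit Types P Q S : delzant R n.

Definition delzant_ball P (e : R) Q := (hausdorff_dist P Q < e%:E)%E.

Lemma delzant_ball_gt0 P e Q : delzant_ball P e Q -> 0 < e.
Proof.
rewrite /delzant_ball /hausdorff_dist gt_max => /andP[h _].
have [[[[p Pp] _] _] _ _ _] := delzantP P.
rewrite -lte_fin; apply: le_lt_trans h.
apply: (@le_trans _ _ (dist_to_set p Q)).
  by apply: le_ereal_inf_tmp => _ [q _ <-]; rewrite lee_fin sqrtr_ge0.
by apply: ereal_sup_ubound; exists p.
Qed.

Lemma delzant_ball_center P (e : R) : 0 < e -> delzant_ball P e P.
Proof.
move=> e0; apply/hausdorff_dist_ltP => //; exists 0.
by split=> // p Pp; exists p; rewrite ?euclidean_distxx.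
Qed.

Lemma delzant_ball_sym P Q (e : R) : delzant_ball P e Q -> delzant_ball Q e P.
Proof. by rewrite /delzant_ball hausdorff_distC. Qed.

Lemma delzant_ball_triangle P Q S (e1 e2 : R) :
  delzant_ball P e1 Q -> delzant_ball Q e2 S -> delzant_ball P (e1 + e2) S.
Proof.
move=> h1 h2; have e1_gt0 := delzant_ball_gt0 h1.
have e2_gt0 := delzant_ball_gt0 h2.
move: h1 h2 => /(hausdorff_dist_ltP _ _ e1_gt0)[r1 [r1e h1 h1']].
move=> /(hausdorff_dist_ltP _ _ e2_gt0)[r2 [r2e h2 h2']].
apply/hausdorff_dist_ltP; first exact: addr_gt0.
exists (r1 + r2); split; first exact: ltrD.
  move=> p /h1[q /h2[s Ss qs] pq]; exists s => //.
  by apply: le_trans (euclidean_dist_triangle p q s) _; apply: lerD.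
move=> s /h2'[q /h1'[p Pp qp] sq]; exists p => //.
by apply: le_trans (euclidean_dist_triangle s q p) _; rewrite addrC lerD.
Qed.

HB.instance Definition _ := hasNbhs.Build (delzant R n)
  (nbhs_ (entourage_ delzant_ball)).
HB.instance Definition _ := Nbhs_isPseudoMetric.Build R (delzant R n)
  erefl delzant_ball_center delzant_ball_sym delzant_ball_triangle erefl.

End DelzantSpace.

(** Paths are functions on [R], of which only the values on [0, 1] matter. *)

Section Paths.
Context {R : realType}.

Definition is_path (T : topologicalType) (g : R -> T) :=
  {within `[0, 1], continuous g}.

Definition is_loop (T : topologicalType) (g : R -> T) :=
  is_path g /\ g 0 = g 1.

(* [g] is homotopic to the constant loop, relative to the endpoints. *)
Definition null_homotopic (T : topologicalType) (g : R -> T) :=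
  exists H : R * R -> T,
    [/\ {within `[0, 1] `*` `[0, 1], continuous H},
        forall t : R, t \in `[0, 1] -> H (0, t) = g t,
        forall t : R, t \in `[0, 1] -> H (1, t) = g 0 &
        forall s : R, s \in `[0, 1] -> H (s, 0) = g 0 /\ H (s, 1) = g 0].

Definition locally_refining (n : nat) (g : R -> delzant R n) :=
  forall t0 : R, t0 \in `[0, 1] -> exists2 e : R, 0 < e &
    forall t : R, t \in `[0, 1] -> `|t - t0| <= e ->
      refines (normal_fan (g t)) (normal_fan (g t0)).

End Paths.

(* Main.v *)
Require Import Defs.
From mathcomp Require Import all_boot all_order all_algebra.
From mathcomp Require Import all_classical all_reals all_analysis.
From mathcomp Require Import ring lra zify.

Set Implicit Arguments.
Unset Strict Implicit.
Unset Printing Implicit Defensive.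
Import Order.TTheory GRing.Theory Num.Theory.
Import numFieldNormedType.Exports.

Local Open Scope classical_set_scope.
Local Open Scope ring_scope.

(** If the normal fan of [P] refines that of [Q], every combination
(1 - s)P + sQ with [s < 1] has the normal fan of [P]; so if [P] is Delzant the
whole segment from [P] to [Q] consists of Delzant polytopes
([fan_refines_mcomb_charted], [mcomb_delzant]).

Near [t0] the fans of a locally refining path [g] refine the fan of [g t0].
Hence a short piece of the path from [g a] to [g b] can be deformed, with fixed
ends, into the segment from [g a] to [g t0] followed by the one from [g t0] to
[g b] ([straightened_local]).  By completeness of the real line, finitely many
pieces suffice ([straightened_unit_interval]): the loop is homotopic to a
polygonal one, in which only finitely many Delzant polytopes [g a], [g t0]
occur.  Their fans have a common refinement: there is one [S] whose fan refines
all of theirs ([common_refinement]).  Adding any positive multiple of [S] to a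
point of the polygonal loop, or to a combination of it with the base point,
gives a Delzant polytope.  So the polygonal loop contracts linearly to the base
point, provided that some [S] is mixed in at the intermediate times; the weight
of [S] vanishes at both ends of the loop, which keeps them fixed
([straightened_null_homotopic]).

The common refinement is the heart of the matter; it is a projective and
unimodular form of toric resolution.  Start from the cube and truncate faces of
codimension two.  Cutting off the face with inner normals [u] and [v] inserts
the ray of [u + v] into the normal fan and keeps it unimodular
([truncate_fan_data]).  Given a lattice vector [m], repeatedly truncate at a
pair with [m] positive on [u] and negative on [v] for which m(u) - m(v) is
largest: all new pairs of this kind have a smaller difference, as in the work of
De Concini and Procesi, so after finitely many steps [m] has constant sign on
every normal cone ([make_sign_constant]).  Once this is done for the edge
directions of the given polytopes, the fan refines all their fans
([sign_constant_refines]).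

Delzant polytopes are handled through charts: a chart of [P] at [p] is a
unimodular integer matrix whose columns are inner normals that attain their
minimum over [P] at [p], the rows of the inverse matrix being the edge
directions at [p].  Delzant polytopes are exactly the polytopes in which every
linear form is minimised at the centre of a chart along whose edges it does not
decrease ([charted_delzant], [delzant_charted]).  The second of these needs the
fact behind the simplex method: a linear form that is not maximal at a vertex
increases along some edge through it ([improving_edge]). *)

(** * Pairings, lattice bases and convex hulls *)

Lemma small_common_eps (R : realType) (T : eqType) (s : seq T) (Q : T -> R -> Prop) :
  (forall x e e', Q x e -> 0 < e' -> e' <= e -> Q x e') ->
  (forall x, x \in s -> exists2 e, 0 < e & Q x e) ->
  exists2 e, 0 < e & forall x, x \in s -> Q x e.
Proof.
move=> Qle; elim: s => [|x s IH] h; first by exists 1.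
have [|e e0 he] := IH; first by move=> y ys; apply: h; rewrite inE ys orbT.
have [e' e'0 he'] := h x (mem_head _ _).
exists (Num.min e e'); first by rewrite lt_min e0.
move=> y; rewrite inE => /predU1P[->|/he]; move: e0 e'0 he' => e0 e'0 he'.
  by apply: Qle he' _ _; rewrite ?lt_min ?e0 // ge_min lexx orbT.
by move=> /Qle; apply; rewrite ?lt_min ?e0 // ge_min lexx.
Qed.

Section Pairing.
Context {R : realType} {n : nat}.
Implicit Types (x y p q : 'rV[R]_n) (a c : 'cV[R]_n) (u v : 'cV[int]_n).

Lemma pairingE c x : pairing c x = \sum_j x 0 j * c j 0.
Proof. by rewrite /pairing mxE. Qed.

Lemma pairingD c x y : pairing c (x + y) = pairing c x + pairing c y.
Proof. by rewrite /pairing mulmxDl mxE. Qed.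

Lemma pairingZ c t x : pairing c (t *: x) = t * pairing c x.
Proof. by rewrite /pairing -scalemxAl mxE. Qed.

Lemma pairingB c x y : pairing c (x - y) = pairing c x - pairing c y.
Proof. by rewrite pairingD -scaleN1r pairingZ mulN1r. Qed.

Lemma pairing0 c : pairing c 0 = 0.
Proof. by rewrite /pairing mul0mx mxE. Qed.

Lemma pairing_sum (I : finType) c (F : I -> 'rV[R]_n) :
  pairing c (\sum_i F i) = \sum_i pairing c (F i).
Proof. by rewrite /pairing mulmx_suml summxE. Qed.

Lemma pairingDl a c x : pairing (a + c) x = pairing a x + pairing c x.
Proof. by rewrite /pairing mulmxDr mxE. Qed.

Lemma pairingZl c t x : pairing (t *: c) x = t * pairing c x.
Proof. by rewrite /pairing -scalemxAr mxE. Qed.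

Lemma pairingNl c x : pairing (- c) x = - pairing c x.
Proof. by rewrite -scaleN1r pairingZl mulN1r. Qed.

Lemma pairing_suml (I : finType) (P : pred I) (F : I -> 'cV[R]_n) x :
  pairing (\sum_(i | P i) F i) x = \sum_(i | P i) pairing (F i) x.
Proof. by rewrite /pairing mulmx_sumr summxE. Qed.

Lemma pairing_delta j x : pairing (delta_mx j 0) x = x 0 j.
Proof. by rewrite /pairing -colE mxE. Qed.

Definition ev u x : R := pairing (map_mx intr u) x.

Definition zpair u (z : 'rV[int]_n) : int := (z *m u) 0 0.

Definition real_row (z : 'rV[int]_n) : 'rV[R]_n := map_mx intr z.

Lemma ev_real_row u z : ev u (real_row z) = (zpair u z)%:~R.
Proof. by rewrite /ev /pairing -map_mxM mxE. Qed.

Lemma evD u x y : ev u (x + y) = ev u x + ev u y.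
Proof. exact: pairingD. Qed.

Lemma evB u x y : ev u (x - y) = ev u x - ev u y.
Proof. exact: pairingB. Qed.

Lemma ev_step u x t z : ev u (x + t *: real_row z) = ev u x + t * (zpair u z)%:~R.
Proof. by rewrite evD {2}/ev pairingZ; congr (_ + _ * _); exact: ev_real_row. Qed.

Lemma evDl u v x : ev (u + v) x = ev u x + ev v x.
Proof. by rewrite /ev map_mxD pairingDl. Qed.

Lemma zpairDl u v z : zpair (u + v) z = zpair u z + zpair v z.
Proof. by rewrite /zpair mulmxDr mxE. Qed.

Lemma real_rowB (y z : 'rV[int]_n) : real_row (y - z) = real_row y - real_row z.
Proof. exact: map_mxB. Qed.

End Pairing.

Section Unimodular.
Context {n : nat}.
Implicit Types (U : 'M[int]_n).

Definition normal U i : 'cV[int]_n := col i U.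
Definition edgevec U i : 'rV[int]_n := row i (invmx U).

Lemma zpair_dual U i j : U \in unitmx ->
  zpair (normal U i) (edgevec U j) = (i == j)%:R.
Proof.
move=> Uu; rewrite /zpair /normal /edgevec -row_mul colE mulmxA mulVmx //.
by rewrite mul1mx !mxE eqxx andbT eq_sym.
Qed.

Lemma normal_inj U i j : U \in unitmx -> normal U i = normal U j -> i = j.
Proof.
move=> Uu e; have := zpair_dual i i Uu; rewrite {1}e zpair_dual // eqxx.
by case: eqP => [->|].
Qed.

Context {R : realType}.
Implicit Types (x y : 'rV[R]_n) (c : 'cV[R]_n).

Lemma ev_normal U i x : ev (normal U i) x = (x *m map_mx intr U) 0 i.
Proof. by rewrite /ev /pairing /normal map_col colE mulmxA -colE mxE. Qed.

Lemma realm_inv U : U \in unitmx ->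
  map_mx intr U *m map_mx intr (invmx U) = 1%:M :> 'M[R]_n.
Proof. by move=> Uu; rewrite -map_mxM mulmxV // map_mx1. Qed.

Lemma ev_inj U x y : U \in unitmx ->
  (forall i, ev (normal U i) x = ev (normal U i) y) -> x = y.
Proof.
move=> Uu h; have e : x *m map_mx intr U = y *m map_mx intr U.
  by apply/rowP => i; rewrite -!ev_normal.
by rewrite -[x]mulmx1 -[y]mulmx1 -(realm_inv Uu) !mulmxA e.
Qed.

(** The edge vectors of a unimodular matrix are the basis dual to its columns, so that
this is the expansion of [c] in the basis of normals. *)
Lemma pairing_chart U c x : U \in unitmx ->
  pairing c x = \sum_i ev (normal U i) x * pairing c (real_row (edgevec U i)).
Proof.
move=> Uu; rewrite /pairing -{1}[x]mulmx1 -(realm_inv Uu) mulmxA -mulmxA.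
rewrite mxE; apply: eq_bigr => i _; rewrite ev_normal; congr (_ * _).
by rewrite /real_row /edgevec map_row -row_mul [RHS]mxE.
Qed.

Lemma zpair_chart U (u : 'cV[int]_n) z : U \in unitmx ->
  zpair u z = \sum_i zpair (normal U i) z * zpair u (edgevec U i).
Proof.
move=> Uu; rewrite /zpair -{1}[z]mulmx1 -(mulmxV Uu) mulmxA -mulmxA.
rewrite mxE; apply: eq_bigr => i _; congr (_ * _).
  by rewrite /normal colE mulmxA -colE [RHS]mxE.
by rewrite /edgevec -row_mul [RHS]mxE.
Qed.

Lemma step_along U k x y : U \in unitmx ->
  (forall l, l != k -> ev (normal U l) y = ev (normal U l) x) ->
  y = x + (ev (normal U k) y - ev (normal U k) x) *: real_row (edgevec U k).
Proof.
move=> Uu h; apply: (ev_inj Uu) => l; rewrite ev_step zpair_dual //.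
by have [->|/h ->] := eqVneq l k; rewrite ?mulr1 ?mulr0 ?addr0 // addrC subrK.
Qed.

End Unimodular.

Section Hull.
Context {R : realType} {n : nat}.

Definition hull (I : finType) (a : I -> 'rV[R]_n) : set 'rV[R]_n :=
  [set x | exists w : I -> R, [/\ forall i, 0 <= w i, \sum_i w i = 1 &
                                 x = \sum_i w i *: a i]].

Lemma convex_hullE m (A : 'M[R]_(m, n)) : convex_hull A = hull (fun i => row i A).
Proof.
apply/seteqP; split=> x.
  move=> [w [w0 w1] <-]; exists (fun i => w 0 i); split=> //.
  by rewrite mulmx_sum_row.
move=> [w [w0 w1 ->]]; exists (\row_i w i); first split.
- by move=> i; rewrite mxE.
- by rewrite -w1; apply: eq_bigr => i _; rewrite mxE.
- by rewrite mulmx_sum_row; apply: eq_bigr => i _; rewrite mxE.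
Qed.

Lemma hull_vertex (I : finType) (a : I -> 'rV[R]_n) i : hull a (a i).
Proof.
exists (fun j => (j == i)%:R); split=> [j||]; first by case: eqP.
  by rewrite (bigD1 i) //= eqxx big1 ?addr0 // => j /negPf ->.
by rewrite (bigD1 i) //= eqxx scale1r big1 ?addr0 // => j /negPf ->; rewrite scale0r.
Qed.

Lemma hull_polytope (I : finType) (a : I -> 'rV[R]_n) (i0 : I) : polytope (hull a).
Proof.
split; first by exists (a i0); exact: hull_vertex.
exists #|I|, (\matrix_(k < #|I|) a (enum_val k)).
rewrite convex_hullE; apply/seteqP; split=> x [w [w0 w1 ->]].
  exists (fun k => w (enum_val k)); split=> //.
    by rewrite -w1 [RHS](reindex_onto (@enum_val I I) enum_rank) /= => [|j _];
      rewrite ?enum_rankK //; apply: eq_bigl => k; rewrite enum_valK eqxx.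
  rewrite (reindex_onto (@enum_val I I) enum_rank) /= => [|j _]; last first.
    by rewrite enum_rankK.
  by apply: eq_big => k; rewrite ?enum_valK ?eqxx // rowK.
exists (fun i => w (enum_rank i)); split=> //.
  rewrite -w1 [LHS](reindex_onto (@enum_val I I) enum_rank) /= => [|j _].
    by apply: eq_big => k; rewrite ?enum_valK ?eqxx.
  by rewrite enum_rankK.
rewrite [RHS](reindex_onto (@enum_val I I) enum_rank) /= => [|j _].
  by apply: eq_big => k; rewrite ?enum_valK ?eqxx // rowK.
by rewrite enum_rankK.
Qed.

Lemma polytopeP (P : set 'rV[R]_n) : polytope P ->
  exists (I : finType) (a : I -> 'rV[R]_n) (i0 : I), P = hull a.
Proof.
move=> [[x Px] [m [A PA]]]; move: Px; rewrite PA convex_hullE => Px.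
case: m => [|m] in A PA Px *.
  by move: Px => [w [_]]; rewrite big_ord0 => /esym/eqP; rewrite oner_eq0.
by exists 'I_m.+1, (fun i => row i A), ord0.
Qed.

Lemma hull_pairing (I : finType) (a : I -> 'rV[R]_n) (c : 'cV[R]_n) (h : R) x :
  (forall i, h <= pairing c (a i)) -> hull a x -> h <= pairing c x.
Proof.
move=> ha [w [w0 w1 ->]]; rewrite pairing_sum -[h]mul1r -w1 mulr_suml.
by apply: ler_sum => i _; rewrite pairingZ ler_wpM2l.
Qed.

Lemma hull_convex (I : finType) (a : I -> 'rV[R]_n) x y t :
  0 <= t <= 1 -> hull a x -> hull a y -> hull a ((1 - t) *: x + t *: y).
Proof.
move=> /andP[t0 t1] [w [w0 w1 ->]] [w' [w'0 w'1 ->]].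
exists (fun i => (1 - t) * w i + t * w' i); split=> [i||].
- by rewrite addr_ge0 // mulr_ge0 // subr_ge0.
- by rewrite big_split /= -!mulr_sumr w1 w'1 !mulr1 subrK.
- rewrite !scaler_sumr -big_split /=; apply: eq_bigr => i _.
  by rewrite [RHS]scalerDl !scalerA.
Qed.

Lemma sum_pair_weights (I J : finType) (w : I * J -> R) (a : I -> 'rV[R]_n)
    (b : J -> 'rV[R]_n) s t :
  \sum_k w k *: (s *: a k.1 + t *: b k.2) =
  s *: (\sum_i (\sum_j w (i, j)) *: a i) + t *: (\sum_j (\sum_i w (i, j)) *: b j).
Proof.
have -> : s *: (\sum_i (\sum_j w (i, j)) *: a i) =
    \sum_i \sum_j w (i, j) *: (s *: a i).
  rewrite scaler_sumr; apply: eq_bigr => i _.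
  by rewrite scaler_suml scaler_sumr; apply: eq_bigr => j _; rewrite !scalerA mulrC.
have -> : t *: (\sum_j (\sum_i w (i, j)) *: b j) =
    \sum_i \sum_j w (i, j) *: (t *: b j).
  rewrite scaler_sumr exchange_big; apply: eq_bigr => j _ /=.
  by rewrite scaler_suml scaler_sumr; apply: eq_bigr => i _; rewrite !scalerA mulrC.
rewrite !pair_bigA -big_split; apply: eq_bigr => -[i j] _ /=.
exact: scalerDr.
Qed.

Definition mcomb (s : R) (P Q : set 'rV[R]_n) : set 'rV[R]_n :=
  [set x | exists p q, [/\ P p, Q q & x = (1 - s) *: p + s *: q]].

(** The Minkowski combination of two hulls is the hull of the combinations of their
generators, as the products of two families of weights show. *)
Lemma mcomb_polytope s P Q : polytope P -> polytope Q -> polytope (mcomb s P Q).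
Proof.
move=> /polytopeP[I [a [i0 ->]]] /polytopeP[J [b [j0 ->]]].
suff -> : mcomb s (hull a) (hull b) =
    hull (fun k : I * J => (1 - s) *: a k.1 + s *: b k.2).
  exact: (hull_polytope _ (i0, j0)).
apply/seteqP; split=> x.
  move=> [p [q [[w [w0 w1 ->]] [w' [w'0 w'1 ->]] ->]]].
  exists (fun k => w k.1 * w' k.2); split=> [k||].
  - by rewrite mulr_ge0.
  - rewrite -(pair_bigA _ (fun i j => w i * w' j)) /=.
    by rewrite -w1; apply: eq_bigr => i _; rewrite -mulr_sumr w'1 mulr1.
  - rewrite sum_pair_weights /=; congr (_ *: _ + _ *: _); apply: eq_bigr => i _.
      by rewrite -mulr_sumr w'1 mulr1.
    by rewrite -mulr_suml w1 mul1r.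
move=> [w [w0 w1 ->]].
exists (\sum_i (\sum_j w (i, j)) *: a i), (\sum_j (\sum_i w (i, j)) *: b j); split.
- exists (fun i => \sum_j w (i, j)); split=> [i||//]; first exact: sumr_ge0.
  by rewrite pair_bigA /= -w1; apply: eq_bigr => -[].
- exists (fun j => \sum_i w (i, j)); split=> [j||//]; first exact: sumr_ge0.
  by rewrite exchange_big pair_bigA /= -w1; apply: eq_bigr => -[].
- exact: sum_pair_weights.
Qed.

Lemma mcombC s P Q : mcomb s P Q = mcomb (1 - s) Q P.
Proof.
apply/seteqP; split=> x [p [q [Pp Qq ->]]]; exists q, p; split=> //.
  by rewrite addrC opprB addrCA subrr addr0.
by rewrite [in RHS]addrC opprB addrCA subrr addr0.
Qed.

Lemma mcomb1 P Q : P !=set0 -> mcomb 1 P Q = Q.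
Proof.
move=> [x Px]; apply/seteqP; split=> [_ [p [q [_ Qq ->]]]|q Qq].
  by rewrite subrr scale0r add0r scale1r.
by exists x, q; split=> //; rewrite subrr scale0r add0r scale1r.
Qed.

Lemma mcomb0 P Q : Q !=set0 -> mcomb 0 P Q = P.
Proof. by move=> Q0; rewrite mcombC subr0 mcomb1. Qed.

Lemma mcombxx s P : 0 <= s <= 1 -> polytope P -> mcomb s P P = P.
Proof.
move=> s01 /polytopeP[I [a [i0 ->]]]; apply/seteqP; split.
  by move=> _ [p [q [Pp Qq ->]]]; exact: hull_convex.
move=> x Px; exists x, x; split=> //.
by rewrite -scalerDl subrK scale1r.
Qed.

End Hull.

(** * Charts of a polytope at its vertices *)

Section Charts.
Context {R : realType} {n : nat}.
Implicit Types (P Q E F : set 'rV[R]_n) (p q x y : 'rV[R]_n) (U : 'M[int]_n).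
Implicit Types (c a : 'cV[R]_n).

(** The forms attaining their minimum over [P] at [y] make up an inner normal cone,
so this says that the cone spanned by the columns of [U] lies in that of [y]. *)
Definition lowest U P y :=
  P y /\ forall i x, P x -> ev (normal U i) y <= ev (normal U i) x.

Definition chart P p U :=
  [/\ U \in unitmx, lowest U P p &
      forall i, exists2 t, 0 < t & P (p + t *: real_row (edgevec U i))].

(** The last condition puts [c] into the cone of the chart: the cones of the charts
cover the dual space. *)
Definition charted P := polytope P /\ forall c, exists p U,
  chart P p U /\ forall i, 0 <= pairing c (real_row (edgevec U i)).

Lemma lowest_pairing U P p c x : U \in unitmx -> lowest U P p ->
  (forall i, 0 <= pairing c (real_row (edgevec U i))) -> P x ->
  pairing c p <= pairing c x.
Proof.
move=> Uu [Pp low] c0 Px; rewrite -subr_ge0 -pairingB (pairing_chart _ _ Uu).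
by apply: sumr_ge0 => i _; rewrite mulr_ge0 // evB subr_ge0 low.
Qed.

Definition chart_edge P p U k : set 'rV[R]_n :=
  [set x | P x /\ forall l, l != k -> ev (normal U l) x = ev (normal U l) p].

Section OneChart.
Variables (P : set 'rV[R]_n) (p : 'rV[R]_n) (U : 'M[int]_n).
Hypothesis pU : chart P p U.

Let b i : 'rV[R]_n := real_row (edgevec U i).

Lemma chart_edge_base k : chart_edge P p U k p.
Proof. by case: pU => _ [Pp _] _. Qed.

Lemma chart_edge_end k : exists2 t, 0 < t & chart_edge P p U k (p + t *: b k).
Proof.
have [Uu _ /(_ k)[t t0 Pt]] := pU; exists t => //; split=> // l lk.
by rewrite ev_step zpair_dual // (negPf lk) mulr0 addr0.
Qed.

Lemma chart_edgeP k x : chart_edge P p U k x -> exists2 s, 0 <= s & x = p + s *: b k.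
Proof.
have [Uu [Pp low] _] := pU; move=> [Px xE].
exists (ev (normal U k) x - ev (normal U k) p); first by rewrite subr_ge0 low.
exact: step_along.
Qed.

Lemma chart_edgevec_neq0 k : b k != 0.
Proof.
have [Uu _ _] := pU; apply/eqP => b0.
have := ev_real_row (R := R) (normal U k) (edgevec U k).
rewrite -/(b k) b0 zpair_dual // eqxx /ev pairing0 => /esym/eqP.
by rewrite oner_eq0.
Qed.

(** The face on which the sum of the selected normals is minimal: each summand is
minimal at [p], so the sum is minimal exactly where all the summands are. *)
Lemma chart_face (p1 : pred 'I_n) :
  face P [set x | P x /\ forall l, p1 l -> ev (normal U l) x = ev (normal U l) p].
Proof.
have [Uu [Pp low] _] := pU; split; first by exists p.
exists (- \sum_(l | p1 l) map_mx intr (normal U l)).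
apply/seteqP; split=> x [Px h]; split=> //.
  move=> q Pq; rewrite !pairingNl !pairing_suml lerN2; apply: ler_sum => l lk.
  by rewrite -/(ev _ x) h //; exact: low.
move=> l lk; have := h _ Pp; rewrite !pairingNl lerN2 !pairing_suml -subr_le0 -sumrB.
rewrite le_eqVlt ltNge sumr_ge0 => [|j jk]; last by rewrite subr_ge0; exact: low.
rewrite orbF psumr_eq0 => [/allP/(_ l (mem_index_enum _))|j jk].
  by rewrite lk /= subr_eq0 => /eqP.
by rewrite subr_ge0; exact: low.
Qed.

Lemma chart_vertex : vertex P p.
Proof.
have [Uu [Pp low] _] := pU; rewrite /vertex.
suff -> : [set p] = [set x | P x /\ forall l, xpredT l -> ev (normal U l) x = ev (normal U l) p].
  exact: chart_face.
apply/seteqP; split=> x /=; first by move=> ->.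
by move=> [_ h]; apply: (ev_inj Uu) => i; exact: h.
Qed.

Lemma chart_edge_direction k : direction (chart_edge P p U k) <[b k]>%VS.
Proof.
split=> [x y /chart_edgeP[s _ ->] /chart_edgeP[s' _ ->]|W hW].
  by rewrite opprD addrACA subrr add0r -scalerBl memvZ // memv_line.
have [t t0 te] := chart_edge_end k.
have := hW _ _ te (chart_edge_base k); rewrite addrC addKr => tW.
by rewrite -memvE -(scale1r (b k)) -(mulVf (lt0r_neq0 t0)) -scalerA memvZ.
Qed.

Lemma chart_edge_edge k : edge P (chart_edge P p U k).
Proof.
split; first exact: chart_face.
exists <[b k]>%VS; first exact: chart_edge_direction.
by rewrite dim_vline chart_edgevec_neq0.
Qed.

(** A form that is maximal at [p] is non-positive on the edge vectors, and its face
is spanned at [p] by the edge vectors on which it vanishes.  A one-dimensional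
face leaves exactly one of them. *)
Lemma edge_is_chart_edge E : edge P E -> E p -> exists k, E = chart_edge P p U k.
Proof.
have [Uu [Pp low] nbr] := pU; move=> [[_ [a EE]] [V dirV dimV]] Ep.
have step i : exists2 t, 0 < t & P (p + t *: b i) by exact: nbr.
have amax q : P q -> pairing a q <= pairing a p by move: Ep; rewrite EE => -[_]; exact.
have a_le0 i : pairing a (b i) <= 0.
  have [t t0 /amax] := step i.
  by rewrite pairingD pairingZ gerDl pmulr_rle0.
have EP x : E x <-> P x /\ forall i, pairing a (b i) != 0 ->
    ev (normal U i) x = ev (normal U i) p.
  have key : P x -> pairing a p - pairing a x =
      \sum_i (ev (normal U i) x - ev (normal U i) p) * - pairing a (b i).
    move=> Px; rewrite -opprB -pairingB (pairing_chart _ _ Uu) -sumrN.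
    by apply: eq_bigr => i _; rewrite evB mulrN.
  rewrite EE; split=> -[Px h]; split=> //.
    move=> i ai; have e : pairing a p - pairing a x = 0.
      by apply/eqP; rewrite subr_eq0 eq_le h // amax.
    move/eqP: (key Px); rewrite e eq_sym psumr_eq0 => [|j _]; last first.
      by rewrite mulr_ge0 ?subr_ge0 ?low // oppr_ge0.
    move=> /allP/(_ i (mem_index_enum _)).
    by rewrite mulf_eq0 oppr_eq0 (negPf ai) orbF subr_eq0 => /eqP.
  move=> q /amax; suff -> : pairing a x = pairing a p by [].
  apply/eqP; rewrite eq_sym -subr_eq0 key // big1 // => i _.
  have [->|/h ->] := eqVneq (pairing a (b i)) 0; first by rewrite oppr0 mulr0.
  by rewrite subrr mul0r.
have inV i : pairing a (b i) = 0 -> b i \in V.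
  move=> ai; have [t t0 Pt] := step i.
  have Et : E (p + t *: b i).
    apply/EP; split=> // j aj; rewrite ev_step zpair_dual //.
    have [ji|_] := eqVneq j i; last by rewrite mulr0 addr0.
    by move: aj; rewrite ji ai eqxx.
  have := dirV.1 _ _ Et Ep; rewrite addrC addKr => tV.
  by rewrite -(scale1r (b i)) -(mulVf (lt0r_neq0 t0)) -scalerA memvZ.
have [k ak] : exists k, pairing a (b k) = 0.
  apply: contrapT => no.
  have Eone x : E x -> x = p.
    move=> /EP[_ h]; apply: (ev_inj Uu) => i; apply: h; apply/eqP => ai.
    by apply: no; exists i.
  have : (V <= 0)%VS.
    by apply: dirV.2 => x y /Eone -> /Eone ->; rewrite subrr mem0v.
  by rewrite subv0 -dimv_eq0 dimV.
have Vk : V = <[b k]>%VS.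
  apply/esym/eqP; rewrite eqEdim -memvE inV //= dimV.
  by rewrite dim_vline chart_edgevec_neq0.
exists k; apply/seteqP; split=> x.
  move=> /EP[Px h]; split=> // l lk; apply: h; apply/eqP => al.
  have := inV _ al; rewrite Vk => /vlineP[s /(congr1 (ev (normal U l)))].
  rewrite /ev pairingZ -!/(ev _ _) !ev_real_row !zpair_dual // eqxx (negPf lk).
  by rewrite mulr0 => /eqP; rewrite oner_eq0.
move=> [Px h]; apply/EP; split=> // i ai; apply: h.
by apply: contra_neq ai => ->.
Qed.

Lemma edges_at_chart : edges_at P p = range (chart_edge P p U).
Proof.
apply/seteqP; split=> E.
  by move=> [eE Ep]; have [k ->] := edge_is_chart_edge eE Ep; exists k.
by move=> [k _ <-]; split; [exact: chart_edge_edge|exact: chart_edge_base].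
Qed.

Lemma chart_edge_inj : injective (chart_edge P p U).
Proof.
have [Uu _ _] := pU.
move=> i j ij; have [t t0] := chart_edge_end i.
rewrite ij => -[_ h]; apply/eqP; apply: contraT => /h.
rewrite ev_step zpair_dual // eqxx mulr1 => /eqP.
by rewrite -subr_eq0 addrC addKr gt_eqF.
Qed.

(** A common divisor of the entries divides the pairing with the dual normal, which
is 1. *)
Lemma primitive_edgevec k : primitive (edgevec U k).
Proof.
have [Uu _ _] := pU; have := zpair_dual k k Uu; rewrite eqxx /zpair mxE => e.
rewrite /primitive; set d := \big[_/_]_(_ < _) _.
have : (d%:Z %| \sum_j edgevec U k 0 j * normal U k j 0)%Z.
  apply: rpred_sum => j _.
  by rewrite dvdz_mulr // dvdzE absz_nat /d (bigD1 j) //= dvdn_gcdl.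
by rewrite e dvdz1 => /eqP.
Qed.

Lemma primitive_edge_vectors_chart :
  primitive_edge_vectors P p = [set edgevec U i | i in [set: 'I_n]].
Proof.
have [Uu _ _] := pU; apply/seteqP; split=> z.
  move=> [zprim [E /= [eE Ep] [t t0 Et]]].
  have [k kE] := edge_is_chart_edge eE Ep; exists k => //.
  move: Et; rewrite kE => /chart_edgeP[s s0 /addrI tz].
  have zE i : ((zpair (normal U i) z)%:~R : R) * t = s * (i == k)%:R.
    have := congr1 (ev (normal U i)) tz.
    rewrite /ev !pairingZ -!/(ev _ _) !ev_real_row zpair_dual // => tz'.
    by rewrite mulrC [LHS]tz'; case: (i == k).
  pose l := zpair (normal U k) z.
  have l0 : 0 <= l.
    rewrite -(ler0z R) -(pmulr_lge0 _ t0) zE eqxx mulr1 //.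
  have zl : z = l *: edgevec U k.
    apply/rowP => j; have zc := zpair_chart (delta_mx j 0) z Uu.
    move: zc; rewrite {1}/zpair -colE mxE => ->; rewrite (bigD1 k) //= big1.
      by rewrite addr0 [RHS]mxE -/l; congr (_ * _); rewrite /zpair -colE mxE.
    move=> i ik; suff -> : zpair (normal U i) z = 0 by rewrite mul0r.
    have /eqP := zE i; rewrite (negPf ik) mulr0 mulf_eq0 (gt_eqF t0) orbF intr_eq0.
    by move=> /eqP.
  have : (`|l| %| 1)%N.
    rewrite -zprim; apply/dvdn_biggcdP => j _.
    by rewrite zl mxE abszM dvdn_mulr.
  rewrite dvdn1 => /eqP l1; have {}l1 : l = 1 by lia.
  by rewrite zl l1 scale1r.
move=> [k _ <-]; split; first exact: primitive_edgevec.
exists (chart_edge P p U k); first by rewrite edges_at_chart; exists k.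
have [t t0 te] := chart_edge_end k; by exists t.
Qed.

End OneChart.

Lemma charted_face P a : charted P -> exists p U, chart P p U /\
  forall q, P q -> pairing a q <= pairing a p.
Proof.
move=> [_ /(_ (- a))[p [U [pU h]]]]; exists p, U; split=> // q Pq.
have [Uu low _] := pU.
by have := lowest_pairing Uu low h Pq; rewrite !pairingNl lerN2.
Qed.

Lemma charted_edge P E : charted P -> edge P E ->
  exists p U k, chart P p U /\ E = chart_edge P p U k.
Proof.
move=> cP eE; have [[_ [a EE]] _] := eE.
have [p [U [pU pmax]]] := charted_face a cP.
have Ep : E p by rewrite EE; split=> //; case: pU => _ [].
by have [k ->] := edge_is_chart_edge pU eE Ep; exists p, U, k.
Qed.

Lemma charted_vertex P v : charted P -> vertex P v -> exists U, chart P v U.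
Proof.
move=> cP [_ [a vE]]; have [p [U [pU pmax]]] := charted_face a cP.
suff <- : p = v by exists U.
by have : [set v] p by rewrite vE; split=> //; case: pU => _ [].
Qed.

(** A face is cut out by some linear form; the chart in whose cone the opposite form
lies has its centre on that face.  So vertices are centres of charts, and edges
and their primitive vectors can be read off from the charts. *)
Lemma charted_delzant P : charted P -> is_delzant P.
Proof.
move=> cP; have [polP charts] := cP; split.
- split=> //; exists fullv; last by rewrite dimvf /dim /= mul1n.
  split=> [*|W hW]; first exact: memvf.
  have [p [U [pU _]]] := charts 0; have [Uu [Pp _] nbr] := pU.
  apply/subvP => x _.
  have -> : x = \sum_i ev (normal U i) x *: real_row (edgevec U i).
    apply: (ev_inj Uu) => k; rewrite /ev pairing_sum (bigD1 k) //= big1 => [|i ik].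
      by rewrite pairingZ addr0 -!/(ev _ _) ev_real_row zpair_dual // eqxx mulr1.
    by rewrite pairingZ -!/(ev _ _) ev_real_row zpair_dual // eq_sym (negPf ik) mulr0.
  apply: memv_suml => i _; apply: memvZ.
  have [t t0 Pt] := nbr i; have := hW _ _ Pt Pp; rewrite addrC addKr => tW.
  by rewrite -(scale1r (real_row _)) -(mulVf (lt0r_neq0 t0)) -scalerA memvZ.
- move=> v /(charted_vertex cP)[U vU]; rewrite (edges_at_chart vU).
  by rewrite (card_eqr card_II); exact: (inj_card_eq (in2W (chart_edge_inj vU))).
- move=> E /(charted_edge cP)[p [U [k [pU ->]]]].
  exists (map_mx intr (edgevec U k)).
  have -> : map_mx ratr (map_mx intr (edgevec U k)) = real_row (edgevec U k) :> 'rV[R]_n.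
    by apply/rowP => j; rewrite !mxE ratr_int.
  exact: chart_edge_direction.
- move=> v /(charted_vertex cP)[U vU]; exists (invmx U).
    exact: primitive_edge_vectors_chart.
  have [Uu _ _] := vU; move=> z; exists (z *m U); split.
    by rewrite -mulmxA mulmxV // mulmx1.
  by move=> w ->; rewrite -mulmxA mulVmx // mulmx1.
Qed.

End Charts.

(** * Faces of a convex hull *)

Section Faces.
Context {R : realType} {n : nat} {I : finType} (a : I -> 'rV[R]_n).
Implicit Types (c d f h : 'cV[R]_n) (v x y : 'rV[R]_n) (i j : I).

Definition top c : pred I := [pred i | [forall j, pairing c (a j) <= pairing c (a i)]].

Lemma topP c i : reflect (forall j, pairing c (a j) <= pairing c (a i)) (top c i).
Proof. exact: forallP. Qed.

Lemma top_exists c i : exists j, top c j.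
Proof.
have [j _ jmax] := @arg_maxP _ _ _ i xpredT (fun k => pairing c (a k)) isT.
by exists j; apply/topP => k; exact: jmax.
Qed.

Lemma top_value c i j : top c i -> top c j -> pairing c (a i) = pairing c (a j).
Proof. by move=> /topP h /topP h'; apply: le_anti; rewrite h h'. Qed.

Lemma top_hull c i x : top c i -> hull a x -> pairing c x <= pairing c (a i).
Proof.
move=> /topP h hx; rewrite -lerN2 -!pairingNl.
by apply: hull_pairing hx => j; rewrite !pairingNl lerN2.
Qed.

(** For a small positive [e] the form [c] decides the comparison of two generators
unless they tie, and [d] breaks the ties: a face of a face is a face. *)
Lemma top_perturb c d : exists e, forall i,
  top (c + e *: d) i <->
  top c i /\ forall j, top c j -> pairing d (a j) <= pairing d (a i).
Proof.
have [e e0 he] : exists2 e : R, 0 < e & forall x : I * I, x \in enum {: I * I} ->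
    top c x.1 -> ~~ top c x.2 ->
    e * (pairing d (a x.2) - pairing d (a x.1)) < pairing c (a x.1) - pairing c (a x.2).
  apply: small_common_eps => [[i j] e e' /= h e'0 e'e ti tj|[i j] _ /=].
    by have := h ti tj; move: e'0 e'e; have /topP/(_ j) := ti; nra.
  have [/= ti|ti] := boolP (top c i); last by exists 1.
  have [/= tj|tj] := boolP (top c j); first by exists 1.
  have lt_ij : 0 < pairing c (a i) - pairing c (a j).
    rewrite subr_gt0 ltNge; apply: contra tj => ij; apply/topP => k.
    by apply: le_trans ij; exact/topP.
  (* Adding 1 avoids dividing by zero when [d] takes equal values. *)
  pose D := pairing d (a j) - pairing d (a i).
  have D0 : 0 < `|D| + 1 by rewrite ltr_pwDr.
  exists ((pairing c (a i) - pairing c (a j)) / (`|D| + 1)); first exact: divr_gt0.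
  move=> _ _; rewrite -/D mulrAC ltr_pdivrMr // ltr_pM2l //.
  by apply: le_lt_trans (ler_norm D) _; rewrite ltrDl.
have {}he i j : top c i -> ~~ top c j ->
    e * (pairing d (a j) - pairing d (a i)) < pairing c (a i) - pairing c (a j).
  by apply: (he (i, j)); rewrite mem_enum.
exists e => i; split=> [/topP ti|[ci di]].
  have ci : top c i.
    apply: contraT => ci; have [j cj] := top_exists c i.
    have := he _ _ cj ci; have := ti j; rewrite !pairingDl !pairingZl.
    by rewrite mulrBr; lra.
  split=> // j cj; have := ti j; rewrite !pairingDl !pairingZl (top_value ci cj).
  by rewrite lerD2l ler_pM2l.
apply/topP => j; rewrite !pairingDl !pairingZl.
have [cj|cj] := boolP (top c j).
  by rewrite (top_value ci cj) lerD2l ler_pM2l // di.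
by have := he _ _ ci cj; rewrite mulrBr; lra.
Qed.

(** In a convex combination attaining the maximum of [c], only generators attaining
it have nonzero weight. *)
Lemma max_in_direction c v x (W : {vspace 'rV[R]_n}) :
  hull a x -> (forall i, pairing c (a i) <= pairing c x) ->
  (forall i, top c i -> a i - v \in W) -> x - v \in W.
Proof.
move=> [w [w0 w1 xE]] xmax topW.
have xv : x - v = \sum_i w i *: (a i - v).
  by under eq_bigr do rewrite scalerBr; rewrite sumrB -scaler_suml w1 scale1r xE.
rewrite xv; apply: memv_suml => i _.
have : \sum_i w i * (pairing c x - pairing c (a i)) = 0.
  under eq_bigr do rewrite mulrBr; rewrite sumrB -mulr_suml w1 mul1r.
  rewrite {1}xE pairing_sum; apply/eqP; rewrite subr_eq0; apply/eqP.
  by apply: eq_bigr => j _; rewrite pairingZ.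
move=> /eqP; rewrite psumr_eq0 => [/allP/(_ i (mem_index_enum _))|j _]; last first.
  by rewrite mulr_ge0 // subr_ge0.
rewrite mulf_eq0 => /orP[/eqP ->|]; first by rewrite scale0r mem0v.
rewrite subr_eq0 => /eqP xi; apply: memvZ; apply: topW.
by apply/topP => j; rewrite -xi.
Qed.

Lemma top_vertex c i : top c i -> (forall j, top c j -> a j = a i) -> vertex (hull a) (a i).
Proof.
move=> ti uniq; split; first by exists (a i).
exists c; apply/seteqP; split=> x /= => [->|[ax xmax]].
  by split=> [|q aq]; [exact: hull_vertex|exact: top_hull].
have : x - a i \in (0 : {vspace 'rV[R]_n})%VS.
  apply: (max_in_direction ax) => [j|j /uniq ->]; last by rewrite subrr mem0v.
  by apply: xmax; exact: hull_vertex.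
by rewrite memv0 subr_eq0 => /eqP.
Qed.

(** Perturbing [c] by a form that separates two of its maximal generators strictly
decreases the set of maximal generators, until it is a single point. *)
Lemma max_at_vertex (i0 : I) c : exists i,
  vertex (hull a) (a i) /\ forall x, hull a x -> pairing c x <= pairing c (a i).
Proof.
suff [c' [i [ti ci uniq]]] : exists c' i, [/\ top c' i, top c i &
    forall j, top c' j -> a j = a i].
  by exists i; split=> [|x ax]; [exact: top_vertex uniq|exact: top_hull].
have [k] := ubnP #|top c|; elim: k c => // k IH c ck.
have [i ci] := top_exists c i0.
have [uniq|] := pselect (forall j, top c j -> a j = a i); first by exists c, i.
move=> /existsNP[j /not_implyP[cj ji]].
pose d := (a j - a i)^T.
have dij : pairing d (a i) < pairing d (a j).
  rewrite -subr_gt0 -pairingB pairingE.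
  have sq l : (a j - a i) 0 l * d l 0 = ((a j - a i) 0 l) ^+ 2.
    by rewrite [d l 0]mxE expr2.
  under eq_bigr do rewrite sq.
  rewrite lt_neqAle sumr_ge0 ?andbT => [|l _]; last exact: sqr_ge0.
  apply/negP; rewrite eq_sym psumr_eq0 => [/allP h|l _]; last exact: sqr_ge0.
  apply: ji; apply/eqP; rewrite -subr_eq0; apply/eqP/rowP => l.
  by have := h l (mem_index_enum _); rewrite /= sqrf_eq0 => /eqP ->; rewrite mxE.
have [e he] := top_perturb c d.
have [|c' [i' [ti' /he[ci' _] uniq]]] := IH (c + e *: d); last by exists c', i'.
rewrite -ltnS; apply: leq_trans ck; rewrite ltnS; apply: proper_card.
apply/fintype.properP; split; first by apply/fintype.subsetP => l /he[].
exists i => //; apply/negP => /he[_ /(_ _ cj)].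
by rewrite leNgt dij.
Qed.

Section EdgeAtVertex.
Variables (v : 'rV[R]_n) (f a0 : 'cV[R]_n).
Hypothesis v_unique : [set v] =
  [set p | hull a p /\ forall q, hull a q -> pairing a0 q <= pairing a0 p].

Let improving h i := top h i /\ pairing f v < pairing f (a i).

(** Let [c] have its strict maximum over the generators at [v].  Tilting [c] towards
[f] until [v] ceases to be the only maximum, the minimality of the face of [h]
forces the tilted form to be constant on this face.  Hence [c] is proportional to
[f] there.  Since every small perturbation of [a0] is such a [c], all linear
forms are proportional to [f] on the face, which is therefore a segment. *)
Lemma edge_direction_is_line h iv i1 :
  a iv = v -> top h iv -> improving h i1 ->
  (forall h' i', top h' iv -> improving h' i' -> (#|top h| <= #|top h'|)%N) ->
  forall i, top h i -> a i - v \in <[a i1 - v]>%VS.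
Proof.
move=> ivE hiv [hi1 fi1] minh.
(* The factor [l] is the weight of [c] against [f] below which [v] is no longer maximal. *)
have strict_prop c : (forall i, a i != v -> pairing c (a i) < pairing c v) ->
    exists2 l, 0 < l & forall i, top h i ->
      pairing f (a i - v) = - l * pairing c (a i - v).
  move=> cstrict.
  (* The weight of [c] at which generator [i] becomes as good as [v]. *)
  pose rho i := pairing f (a i - v) / - pairing c (a i - v).
  have den i : pairing f v < pairing f (a i) -> 0 < - pairing c (a i - v).
    move=> fi; rewrite oppr_gt0 pairingB subr_lt0 cstrict //.
    by apply: contraTneq fi => ->; rewrite ltxx.
  have P1 : top h i1 && (pairing f v < pairing f (a i1)) by rewrite hi1.
  have [i2 /andP[hi2 fi2] i2max] := @arg_maxP _ _ _ i1
    (fun i => top h i && (pairing f v < pairing f (a i))) rho P1.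
  have l0 : 0 < rho i2.
    by rewrite divr_gt0 ?den // pairingB subr_gt0.
  exists (rho i2) => //.
  pose d := f + rho i2 *: c.
  have dv i : top h i -> pairing d (a i) <= pairing d v.
    move=> hi; rewrite -subr_le0 -pairingB pairingDl pairingZl.
    have [fi|fi] := ltP (pairing f v) (pairing f (a i)); last first.
      rewrite -[leRHS]addr0; apply: lerD; first by rewrite pairingB subr_le0.
      rewrite pmulr_rle0 // pairingB subr_le0.
      by have [->|/cstrict/ltW] := eqVneq (a i) v.
    have : rho i <= rho i2 by apply: i2max; rewrite hi.
    by rewrite {1}/rho ler_pdivrMr ?den // mulrN -subr_le0 opprK.
  have d2 : pairing d (a i2) = pairing d v.
    apply/eqP; rewrite -subr_eq0 -pairingB pairingDl pairingZl /rho invrN mulrN mulNr.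
    rewrite divfK ?subrr //.
    by rewrite -oppr_eq0 gt_eqF // den.
  have [e he] := top_perturb h d.
  have tiv : top (h + e *: d) iv by apply/he; split=> // j /dv; rewrite ivE.
  have ti2 : top (h + e *: d) i2 by apply/he; split=> // j /dv; rewrite d2.
  have le := minh _ i2 tiv (conj ti2 fi2).
  have sub : {subset top (h + e *: d) <= top h} by move=> i /he[].
  have eq_top : top (h + e *: d) =i top h.
    by apply/subset_cardP; [apply/eqP; rewrite eqn_leq le subset_leq_card //; exact/fintype.subsetP|exact/fintype.subsetP].
  move=> i hi; have : top (h + e *: d) i = top h i := eq_top i.
  rewrite hi => /he[_ /(_ _ hiv)]; rewrite ivE => vi.
  have : pairing d (a i - v) = 0.
    by rewrite pairingB; apply/eqP; rewrite subr_eq0 eq_le dv.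
  by rewrite pairingDl pairingZl mulNr => /eqP; rewrite addr_eq0 => /eqP.
have vmax q : hull a q -> pairing a0 q <= pairing a0 v.
  by have : [set v] v by []; rewrite {1}v_unique => -[_]; exact.
have a0_strict i : a i != v -> pairing a0 (a i) < pairing a0 v.
  move=> iv'; rewrite lt_neqAle vmax ?andbT; last exact: hull_vertex.
  apply: contra_neqN iv' => /eqP e; suff : [set v] (a i) by [].
  rewrite v_unique; split=> [|q /vmax]; first exact: hull_vertex.
  by rewrite e.
(* Comparing [a0] with its perturbation along a coordinate form expresses that coordinate through [f]. *)
have [l0 l00 f0] := strict_prop _ a0_strict.
have coord (j : 'I_n) : exists k, forall i, top h i -> (a i - v) 0 j = k * pairing f (a i - v).
  have [e e0 he] : exists2 e : R, 0 < e & forall i, i \in enum I -> a i != v ->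
      e * (a i - v) 0 j < - pairing a0 (a i - v).
    apply: small_common_eps => [i e e' he e'0 e'e iv'|i _].
      by have := he iv'; have := a0_strict _ iv'; rewrite pairingB; move: (_ 0 j) => z; nra.
    have [->|iv'] := eqVneq (a i) v; first by exists 1.
    have := a0_strict _ iv'; rewrite -subr_lt0 -pairingB -oppr_gt0 => p0.
    have D0 : 0 < `|(a i - v) 0 j| + 1 by rewrite ltr_pwDr.
    exists (- pairing a0 (a i - v) / (`|(a i - v) 0 j| + 1)); first exact: divr_gt0.
    move=> _; rewrite mulrAC ltr_pdivrMr // ltr_pM2l //.
    by apply: le_lt_trans (ler_norm _) _; rewrite ltrDl.
  have [|l1 l10 f1] := strict_prop (a0 + e *: delta_mx j 0).
    move=> i iv'; rewrite -subr_lt0 -pairingB pairingDl pairingZl pairing_delta.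
    by have := he i (mem_enum _ _) iv'; lra.
  exists ((l0^-1 - l1^-1) / e) => i hi.
  have := f0 _ hi; have := f1 _ hi; rewrite pairingDl pairingZl pairing_delta.
  move=> e1 e2.
  have {}e1 : l1^-1 * pairing f (a i - v) = - (pairing a0 (a i - v) + e * (a i - v) 0 j).
    by rewrite e1 mulrA mulrN mulVf ?lt0r_neq0 // mulN1r.
  have {}e2 : l0^-1 * pairing f (a i - v) = - pairing a0 (a i - v).
    by rewrite e2 mulrA mulrN mulVf ?lt0r_neq0 // mulN1r.
  rewrite mulrAC mulrBl e1 e2 opprK addrA addNr add0r mulrC mulKf //.
  exact: lt0r_neq0.
have f10 : pairing f (a i1 - v) != 0 by rewrite pairingB subr_eq0 gt_eqF.
move=> i hi; apply/vlineP; exists (pairing f (a i - v) / pairing f (a i1 - v)).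
apply/rowP => j; have [k hk] := coord j; rewrite [RHS]mxE !hk //.
by rewrite mulrCA -mulrA mulVf // mulr1 // mulrC.
Qed.

(** Among the faces through [v] on which [f] exceeds its value at [v], one with the
fewest generators is an edge. *)
Lemma improving_edge iv x : a iv = v -> hull a x -> pairing f v < pairing f x ->
  exists E, edges_at (hull a) v E /\ exists2 y, E y & pairing f v < pairing f y.
Proof.
move=> ivE ax fx.
have [i1 fi1] : exists i1, pairing f v < pairing f (a i1).
  apply: contrapT => no; move: fx; rewrite ltNge => /negP; apply.
  rewrite -lerN2 -!pairingNl; apply: hull_pairing ax => i.
  by rewrite !pairingNl lerN2 leNgt; apply/negP => ?; apply: no; exists i.
(* The zero form selects the whole polytope, so that there is a face to minimise over. *)
have top0 i : top 0 i by apply/topP => j; rewrite /pairing !mulmx0.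
have [h [hiv [i' himp] minh]] : exists h, [/\ top h iv, exists i', improving h i' &
    forall h' i', top h' iv -> improving h' i' -> (#|top h| <= #|top h'|)%N].
  have : exists h, top h iv /\ exists i', improving h i'.
    by exists 0; split=> //; exists i1.
  move=> [h]; have [k] := ubnP #|top h|; elim: k h => // k IH h hk [hiv himp].
  have [[h' [h'iv [i' h'imp] lt]]|no] := pselect (exists h',
      [/\ top h' iv, exists i', improving h' i' & (#|top h'| < #|top h|)%N]).
    by apply: (IH h'); [exact: leq_trans lt _|split=> //; exists i'].
  exists h; split=> // h' i' h'iv h'imp; rewrite leqNgt; apply/negP => lt.
  by apply: no; exists h'; split=> //; exists i'.
have line := edge_direction_is_line ivE hiv himp minh.
have [hi' fi'] := himp.
pose E := [set p | hull a p /\ forall q, hull a q -> pairing h q <= pairing h p].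
have Etop i : top h i -> E (a i).
  by move=> hi; split=> [|q]; [exact: hull_vertex|exact: top_hull].
have Eline y : E y -> y - v \in <[a i' - v]>%VS.
  move=> [ay ymax]; apply: (max_in_direction ay _ line) => i.
  by apply: ymax; exact: hull_vertex.
exists E; split; last by exists (a i') => //; exact: Etop.
split; last by rewrite -ivE; exact: Etop.
split; first by split; [exists (a i'); exact: Etop|exists h].
exists <[a i' - v]>%VS; last first.
  rewrite dim_vline; suff -> : a i' - v != 0 by [].
  by rewrite subr_eq0; apply: contraTneq fi' => ->; rewrite ltxx.
split=> [y z /Eline yl /Eline zl|W hW].
  by have := memvB yl zl; rewrite opprB addrA subrK.
by rewrite -memvE; apply: hW; [exact: Etop|rewrite -ivE; exact: Etop].
Qed.

End EdgeAtVertex.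

End Faces.

(** * Delzant polytopes and refinement of normal fans *)

Section PrimitiveVector.
Context {n : nat}.

(** Clear denominators, then divide by the greatest common divisor of the entries. *)
Lemma rational_row_primitive (w : 'rV[rat]_n) : w != 0 ->
  exists (z : 'rV[int]_n) (r : rat), primitive z /\ w = r *: map_mx intr z.
Proof.
move=> w0.
pose d := \prod_j denq (w 0 j).
have d0 : d != 0 by apply/prodf_neq0 => j _; exact: denq_neq0.
pose y : 'rV[int]_n := \row_j (numq (w 0 j) * \prod_(i | i != j) denq (w 0 i)).
have yE j : (y 0 j)%:~R = d%:~R * w 0 j :> rat.
  rewrite mxE /d [in RHS](bigD1 j) //= !rmorphM /= numqE.
  ring.
(* The integer row [y] is [w] with its denominators cleared. *)
pose g := \big[gcdn/0%N]_j absz (y 0 j).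
have gdvd j : (g %| absz (y 0%R j))%N by rewrite /g (bigD1 j) //= dvdn_gcdl.
have g0 : (0 < g)%N.
  rewrite lt0n; apply: contraNneq w0 => gE; apply/eqP/rowP => j; rewrite mxE.
  have := gdvd j; rewrite gE dvd0n absz_eq0 => /eqP yj; have := yE j.
  by rewrite yj => /esym/eqP; rewrite mulf_eq0 intr_eq0 (negPf d0) => /eqP.
pose z : 'rV[int]_n := \row_j (y 0%R j %/ g)%Z.
have zy j : z 0 j * g%:Z = y 0 j.
  by rewrite mxE divzK // dvdzE absz_nat.
exists z, (g%:Q / d%:~R); split.
  rewrite /primitive; set k := \big[_/_]_(_ < _) _.
  have : (k * g %| g)%N.
    apply/dvdn_biggcdP => j _; rewrite -zy abszM absz_nat dvdn_mul //.
    by rewrite /k (bigD1 j) //= dvdn_gcdl.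
  by rewrite -{2}[g]mul1n dvdn_pmul2r // dvdn1 => /eqP.
apply/rowP => j; rewrite [RHS]mxE [X in _ * X]mxE.
have dQ : d%:~R != 0 :> rat by rewrite intr_eq0.
apply: (mulfI dQ); rewrite -yE -zy rmorphM /=.
by rewrite mulrA [d%:~R * _]mulrC mulfVK // mulrC.
Qed.

Lemma lattice_basis_unit (B : 'M[int]_n) : lattice_basis B -> B \in unitmx.
Proof.
move=> Bb; have /choice[w wE] : forall i : 'I_n, exists w : 'rV[int]_n,
    delta_mx 0 i = w *m B by move=> i; have [w [e _]] := Bb (delta_mx 0 i); exists w.
have : (\matrix_i w i) *m B = 1%:M.
  by apply/row_matrixP => i; rewrite row_mul rowK -wE row1.
by case/mulmx1_unit.
Qed.

End PrimitiveVector.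

Section DelzantCharts.
Context {R : realType} {n : nat}.
Implicit Types (P Q S E F : set 'rV[R]_n) (p q v x y : 'rV[R]_n) (U : 'M[int]_n).
Implicit Types (c f : 'cV[R]_n).

Lemma improving_edge_polytope P v f x : polytope P -> vertex P v -> P x ->
  pairing f v < pairing f x ->
  exists E, edges_at P v E /\ exists2 y, E y & pairing f v < pairing f y.
Proof.
move=> /polytopeP[I [a [i0 ->]]] [_ [a0 vE]] ax fx.
suff [iv ivE] : exists iv, a iv = v by have := improving_edge vE ivE ax fx.
have [iv tiv] := top_exists a a0 i0; exists iv.
suff : [set v] (a iv) by [].
by rewrite vE; split=> [|q]; [exact: hull_vertex|exact: top_hull].
Qed.

(** The primitive vector is chosen according to the side of [v] on which [x] lies on
the line of the edge. *)
Lemma rational_edge_point P v E x : rational_direction E -> edges_at P v E ->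
  E x -> x != v -> exists z t, [/\ primitive_edge_vectors P v z, 0 < t &
    x = v + t *: real_row z].
Proof.
move=> [w wdir] Ev Ex xv; have [_ Evv] := Ev.
have /vlineP[s sE] := wdir.1 _ _ Ex Evv.
have w0 : w != 0.
  apply: contra_neq xv => w0; apply/eqP; rewrite -subr_eq0 sE w0.
  by apply/eqP/rowP => j; rewrite !mxE rmorph0 mulr0.
have [z [r [zp wz]]] := rational_row_primitive w0.
have xz : x - v = (s * ratr r) *: real_row z.
  by rewrite sE wz; apply/rowP => j; rewrite !mxE rmorphM /= ratr_int mulrA.
have xE : x = v + (s * ratr r) *: real_row z by rewrite -xz addrC subrK.
have [t0|t0|t0] := ltgtP (s * ratr r) 0.
- exists (- z), (- (s * ratr r)); rewrite oppr_gt0; split=> //.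
    split.
      by rewrite /primitive -[RHS]zp; apply: eq_bigr => j _; rewrite mxE abszN.
    exists E => //; exists (- (s * ratr r)); first by rewrite oppr_gt0.
    by rewrite map_mxN scaleNr scalerN opprK -xE.
  by rewrite /real_row map_mxN scaleNr scalerN opprK.
- by exists z, (s * ratr r); split=> //; split=> //; exists E => //; exists (s * ratr r); rewrite -?xE.
- by move: xv; rewrite -subr_eq0 xz t0 scale0r eqxx.
Qed.

(** The primitive edge vectors at [v] form a lattice basis; its dual basis provides
the normals.  Each normal is non-negative along all the edges at [v], hence
minimal at [v] over all of [P]. *)
Lemma delzant_chart P v : is_delzant P -> vertex P v -> exists U, chart P v U.
Proof.
move=> [[polP _] _ ratE basis] vv; have [B edgesB Bb] := basis _ vv.
have Bu := lattice_basis_unit Bb; exists (invmx B).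
have eE i : edgevec (invmx B) i = row i B by rewrite /edgevec invmxK.
have Uu : invmx B \in unitmx by rewrite unitmx_inv.
have Pv : P v by case: vv => _ [a0 vE]; have : [set v] v by []; rewrite vE => -[].
split=> //; last first.
  move=> i; have : primitive_edge_vectors P v (row i B) by rewrite edgesB; exists i.
  move=> [_ [E [[[_ [a0 EE]] _] _] [t t0 Et]]]; exists t => //; rewrite eE.
  by move: Et; rewrite EE => -[].
split=> // i x Px; rewrite leNgt; apply/negP => lt.
have lt' : pairing (- map_mx intr (normal (invmx B) i)) v <
    pairing (- map_mx intr (normal (invmx B) i)) x by rewrite !pairingNl ltrN2.
have [E [Ev [y Ey lty]]] := improving_edge_polytope polP vv Px lt'.
have yv : y != v by apply: contraTneq lty => ->; rewrite ltxx.
have [z [t [zv t0 yE]]] := rational_edge_point (ratE _ Ev.1) Ev Ey yv.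
move: zv; rewrite edgesB => -[j _ zj].
move: lty; rewrite !pairingNl ltrN2 -!/(ev _ _) yE -zj -eE ev_step zpair_dual //.
by apply/negP; rewrite -leNgt lerDl mulr_ge0 ?(ltW t0) // ler0z; case: eqP.
Qed.

(** Vertices are among the finitely many generators of [P], so finitely many charts
already have cones that cover the dual space. *)
Lemma delzant_chart_list P : is_delzant P ->
  exists L : seq ('rV[R]_n * 'M[int]_n),
    (forall d, d \in L -> chart P d.1 d.2) /\
    forall c, exists2 d, d \in L & forall i, 0 <= pairing c (real_row (edgevec d.2 i)).
Proof.
move=> dP; have [[polP _] _ _ _] := dP.
have /polytopeP[I [a [i0 PE]]] := polP.
have /choice[U hU] : forall i, exists U, vertex P (a i) -> chart P (a i) U.
  move=> i; have [/(delzant_chart dP)[U hU]|nv] := pselect (vertex P (a i)).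
    by exists U.
  by exists 1%:M.
exists [seq (a i, U i) | i <- enum I & `[< vertex P (a i) >]]; split.
  move=> d /mapP[i]; rewrite mem_filter => /andP[/asboolP vi _] ->; exact: hU.
move=> c; have [i [vi imax]] := max_at_vertex a i0 (- c).
rewrite -PE in vi imax.
exists (a i, U i) => [|k].
  by apply: map_f; rewrite mem_filter mem_enum andbT; apply/asboolP.
have [_ _ /(_ k)[t t0 /imax]] := hU _ vi.
by rewrite !pairingNl lerN2 pairingD pairingZ lerDl pmulr_rge0.
Qed.

Lemma delzant_charted P : is_delzant P -> charted P.
Proof.
move=> dP; split; first by case: dP => -[].
move=> c; have [L [hL /(_ c)[d dL d0]]] := delzant_chart_list dP.
by exists d.1, d.2; split=> //; exact: hL.
Qed.

(** Every maximal cone of the fan of [P] lies in a normal cone of [Q]. *)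
Definition fan_refines P Q := charted P /\ forall p U, chart P p U -> exists y, lowest U Q y.

(** The opposites of the normals of a chart at [p] lie in the normal cone of [P] at
the vertex [p], which is contained in a normal cone of [Q]. *)
Lemma refines_fan_refines P Q : is_delzant P -> refines (normal_fan P) (normal_fan Q) ->
  fan_refines P Q.
Proof.
move=> dP ref; split=> [|p U pU]; first exact: delzant_charted.
have [Uu [Pp low] _] := pU.
have [|_ [F fF <-] sub] := ref (normal_cone P [set p]).
  by exists [set p] => //; exact: chart_vertex pU.
have [[y Fy] [a FE]] := fF; exists y; split; first by move: Fy; rewrite FE => -[].
move=> i x Qx; have : normal_cone P [set p] (- map_mx intr (normal U i)).
  by move=> _ q -> Pq; rewrite pairingNl pairingB opprB subr_ge0; exact: low.
by move=> /sub/(_ y x Fy Qx); rewrite pairingNl pairingB opprB subr_ge0.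
Qed.

Lemma lowest_mcomb s U P Q p q : 0 <= s <= 1 -> lowest U P p -> lowest U Q q ->
  lowest U (mcomb s P Q) ((1 - s) *: p + s *: q).
Proof.
move=> /andP[s0 s1] [Pp lowp] [Qq lowq]; split; first by exists p, q.
move=> i _ [x [y [Px Qy ->]]]; rewrite !evD /ev !pairingZ -!/(ev _ _).
by rewrite lerD // ler_wpM2l ?subr_ge0 //; [exact: lowp|exact: lowq].
Qed.

(** A form in the cone of a chart of [P] at [p] is minimal on [Q] at the point [y]
provided by the refinement; the same matrix is a chart of the combination at the
corresponding combination of [p] and [y]. *)
Lemma fan_refines_mcomb_charted s P Q : 0 <= s < 1 -> polytope Q -> fan_refines P Q ->
  charted (mcomb s P Q).
Proof.
move=> /andP[s0 s1] polQ [[polP charts] below].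
split=> [|c]; first exact: mcomb_polytope.
have [p [U [pU c0]]] := charts c; have [y ylow] := below _ _ pU.
have [Uu plow nbr] := pU.
exists ((1 - s) *: p + s *: y), U; split=> //; split=> //.
  by apply: lowest_mcomb => //; rewrite s0 ltW.
move=> i; have [t t0 Pt] := nbr i; exists ((1 - s) * t).
  by rewrite mulr_gt0 // subr_gt0.
exists (p + t *: real_row (edgevec U i)), y; split=> //; first by case: ylow.
by rewrite scalerDr scalerA addrAC.
Qed.

Lemma fan_refines_mcomb s S P Q : 0 <= s <= 1 -> fan_refines S P -> fan_refines S Q ->
  fan_refines S (mcomb s P Q).
Proof.
move=> s01 [cS belowP] [_ belowQ]; split=> // p U pU.
have [y ylow] := belowP _ _ pU; have [z zlow] := belowQ _ _ pU.
by exists ((1 - s) *: y + s *: z); exact: lowest_mcomb.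
Qed.

End DelzantCharts.

(** * Truncation of codimension-two faces *)

Local Notation corner R n := ('rV[R]_n * 'M[int]_n)%type.

Section Shear.
Context {n : nat}.
Implicit Types (U : 'M[int]_n) (i j k : 'I_n).

(** Right multiplication by an elementary matrix replaces normal [i] by the sum of
normals [i] and [j]; it describes one of the two cones into which the star
subdivision at this sum divides a unimodular cone. *)
Definition shear i j U : 'M[int]_n := U *m (1%:M + delta_mx j i).

Lemma shear_mx_inv i j : i != j ->
  (1%:M + delta_mx j i : 'M[int]_n) *m (1%:M - delta_mx j i) = 1%:M.
Proof.
move=> ij; rewrite mulmxDl mul1mx mulmxBr mulmx1 mul_delta_mx_0 //.
by rewrite subr0 subrK.
Qed.

Lemma shear_unit i j U : i != j -> U \in unitmx -> shear i j U \in unitmx.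
Proof.
by move=> ij Uu; rewrite unitmx_mul Uu; case: (mulmx1_unit (shear_mx_inv ij)).
Qed.

Lemma normal_shear i j U k :
  normal (shear i j U) k = if k == i then normal U i + normal U j else normal U k.
Proof.
rewrite /normal /shear colE mulmxDr mulmx1 mulmxDl -mulmxA.
have [->|ki] := eqVneq k i.
  by rewrite mul_delta_mx -!colE.
by rewrite mul_delta_mx_0 1?eq_sym // mulmx0 addr0 -colE.
Qed.

Lemma edgevec_shear i j U k : i != j -> U \in unitmx ->
  edgevec (shear i j U) k =
    if k == j then edgevec U j - edgevec U i else edgevec U k.
Proof.
move=> ij Uu; have Su := shear_unit ij Uu.
have inv : invmx (shear i j U) = (1%:M - delta_mx j i) *m invmx U.
  apply: (can_inj (mulKmx Su)); rewrite mulmxV // /shear -mulmxA.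
  by rewrite (mulmxA _ _ (invmx U)) shear_mx_inv // mul1mx mulmxV.
rewrite /edgevec inv row_mul linearB /= row1 !rowE mulmxBl.
have [->|kj] := eqVneq k j; first by rewrite mul_delta_mx.
by rewrite mul_delta_mx_0 // mul0mx subr0.
Qed.

End Shear.

Section Corners.
Context {R : realType} {n : nat}.

Implicit Types (D : seq (corner R n)) (c d : corner R n) (u v : 'cV[int]_n).

(** A combinatorial form of a Delzant polytope: its vertices with the inner normals
at each of them, such that all vertices satisfy all facet inequalities and every
edge ray at a vertex meets a further vertex. *)
Definition fan_data D :=
  [/\ forall c, c \in D -> c.2 \in unitmx,
      forall c d, c \in D -> d \in D ->
        forall i, ev (normal c.2 i) c.1 <= ev (normal c.2 i) d.1 &
      forall c, c \in D -> forall i, exists2 d, d \in D &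
        exists2 t, 0 < t & d.1 = c.1 + t *: real_row (edgevec c.2 i)].

Definition normal_at u c := exists i, normal c.2 i = u.

(** If the facet inequality of [u] is an equality at the vertex [d], then [u] lies in
the cone of the normals at [d].  A normal at [d] that contributes to [u] is tight
on the whole facet of [u], hence proportional to [u], and the proportionality
factor is 1 because both belong to lattice bases. *)
Lemma normal_at_tight D c d u : fan_data D -> c \in D -> d \in D ->
  normal_at u c -> ev u d.1 = ev u c.1 -> normal_at u d.
Proof.
move=> [D1 D2 D3] cD dD [i <-] tight.
have cu := D1 _ cD; have du := D1 _ dD.
pose g k := zpair (normal c.2 i) (edgevec d.2 k).
have g_ge0 k : 0 <= g k.
  have [d' d'D [t t0 d'E]] := D3 _ dD k.
  have := D2 _ _ cD d'D i; rewrite d'E ev_step tight lerDl pmulr_rge0 //.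
  by rewrite ler0z.
have tight_normal (x : corner R n) k : x \in D -> ev (normal c.2 i) x.1 = ev (normal c.2 i) c.1 ->
    0 < g k -> ev (normal d.2 k) x.1 = ev (normal d.2 k) d.1.
  move=> xD xt gk; apply/eqP; rewrite -subr_eq0 -evB.
  have := pairing_chart (map_mx intr (normal c.2 i)) (x.1 - d.1) du.
  rewrite -/(ev (normal c.2 i) _) evB xt -tight subrr => /esym/eqP.
  rewrite psumr_eq0 => [/allP/(_ k (mem_index_enum _))|l _].
    rewrite mulf_eq0 => /orP[//|].
    by rewrite -/(ev _ _) ev_real_row intr_eq0 gt_eqF.
  apply: mulr_ge0; first by rewrite evB subr_ge0 D2.
  by rewrite -/(ev _ _) ev_real_row ler0z g_ge0.
(* As [normal c.2 i] is not zero, some coefficient of its expansion is not zero. *)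
have [k gk] : exists k, 0 < g k.
  apply: contrapT => h; have g0 k : g k = 0.
    by apply/eqP; rewrite eq_le g_ge0 andbT leNgt; apply/negP => gk; apply: h; exists k.
  have := zpair_chart (normal c.2 i) (edgevec c.2 i) du.
  rewrite zpair_dual // eqxx big1 // => k _; first by rewrite -/(g k) g0 mulr0.
exists k.
have orth l : l != i -> zpair (normal d.2 k) (edgevec c.2 l) = 0.
  move=> li; have [c' c'D [t t0 c'E]] := D3 _ cD l.
  have c't : ev (normal c.2 i) c'.1 = ev (normal c.2 i) c.1.
    by rewrite c'E ev_step zpair_dual // eq_sym (negPf li) mulr0 addr0.
  have /eqP := tight_normal _ _ c'D c't gk.
  rewrite c'E ev_step (tight_normal _ _ cD erefl gk).
  rewrite -subr_eq0 addrC addKr mulf_eq0 gt_eqF //= intr_eq0.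
  by move=> /eqP.
pose l := zpair (normal d.2 k) (edgevec c.2 i).
(* Both integers are 1, since their product is and [g k] is positive. *)
have lg : l * g k = 1.
  have := zpair_chart (normal d.2 k) (edgevec d.2 k) cu.
  rewrite zpair_dual // eqxx (bigD1 i) //= big1 ?addr0 => [e|j ji].
    exact: etrans (mulrC _ _) (esym e).
  by rewrite orth // mulr0.
have l1 : l = 1 by move: lg gk; nia.
apply/colP => a; have := zpair_chart (normal d.2 k) (delta_mx 0 a) cu.
rewrite (bigD1 i) //= big1 ?addr0 => [|j ji]; last by rewrite orth // mulr0.
by rewrite -/l l1 mulr1 /zpair -!rowE !mxE.
Qed.

End Corners.

Section Truncation.
Context {R : realType} {n : nat}.

Implicit Types (D : seq (corner R n)) (c d : corner R n) (u v : 'cV[int]_n).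

(** The vertices on the face of codimension two with inner normals [u] and [v]. *)
Definition on_ridge u v c := normal_at u c /\ normal_at v c.

Definition ridge_pair u v c i j :=
  (normal c.2 i = u /\ normal c.2 j = v) \/ (normal c.2 i = v /\ normal c.2 j = u).

(** Each vertex on the ridge is replaced by two new ones, at distance [e] along the
two edges that leave the ridge.  The new facet has normal [u + v]. *)
Definition cut_corner (e : R) i j c : corner R n :=
  (c.1 + e *: real_row (edgevec c.2 i), shear i j c.2).

Definition truncate e u v D : seq (corner R n) :=
  [seq c <- D | ~~ `[< on_ridge u v c >]] ++
  [seq cut_corner e ij.1 ij.2 c | c <- D,
     ij <- [seq ij <- enum {: 'I_n * 'I_n} | `[< ridge_pair u v c ij.1 ij.2 >]]].

Lemma truncateP e u v D c' : c' \in truncate e u v D <->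
  (c' \in D /\ ~ on_ridge u v c') \/
  exists c i j, [/\ c \in D, ridge_pair u v c i j & c' = cut_corner e i j c].
Proof.
rewrite mem_cat mem_filter; split.
  move=> /orP[/andP[/asboolPn nr cD]|/allpairsPdep[c [[i j] [cD]]]]; first by left.
  by rewrite mem_filter /= => /andP[/asboolP rp _] ->; right; exists c, i, j.
move=> [[cD nr]|[c [i [j [cD rp ->]]]]]; apply/orP; [left|right].
  by rewrite cD andbT; apply/asboolPn.
apply/allpairsPdep; exists c, (i, j); split=> //.
by rewrite mem_filter mem_enum andbT; apply/asboolP.
Qed.

Lemma on_ridgeP u v c : on_ridge u v c <-> exists i j, ridge_pair u v c i j.
Proof.
split=> [[[i iu] [j jv]]|[i [j [[iu jv]|[iv ju]]]]]; first by exists i, j; left.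
  by split; [exists i|exists j].
by split; [exists j|exists i].
Qed.

Lemma ridge_pairC u v c i j : ridge_pair u v c i j -> ridge_pair u v c j i.
Proof. by move=> [[? ?]|[? ?]]; [right|left]. Qed.

Lemma ridge_sum u v c i j : ridge_pair u v c i j -> normal c.2 i + normal c.2 j = u + v.
Proof. by case=> -[-> ->] //; rewrite addrC. Qed.

Variables (D : seq (corner R n)) (c0 : corner R n) (i0 j0 : 'I_n).
Hypotheses (DD : fan_data D) (c0D : c0 \in D) (ij0 : i0 != j0).

Let u := normal c0.2 i0.
Let v := normal c0.2 j0.

Lemma ridge_neq : u <> v.
Proof. by case: DD => D1 _ _ /(normal_inj (D1 _ c0D)) /eqP; rewrite (negPf ij0). Qed.

Lemma ridge_pair_neq c i j : ridge_pair u v c i j -> i != j.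
Proof. by move=> h; apply/eqP => e; apply: ridge_neq; case: h => -[<- <-]; rewrite e. Qed.

Lemma facet_value c d w : c \in D -> d \in D ->
  normal_at w c -> normal_at w d -> ev w c.1 = ev w d.1.
Proof.
case: DD => _ D2 _ cD dD [i iw] [j jw]; apply/eqP; rewrite eq_le.
by rewrite -{1 2}iw D2 //= -{1 2}jw D2.
Qed.

Let h := ev u c0.1 + ev v c0.1.

(** The cut must stop short of the next vertex on every edge, and the new facet must
not reach the vertices outside the ridge. *)
Definition small_cut e :=
  (forall c, c \in D -> forall i, exists2 d, d \in D &
     exists2 t, e < t & d.1 = c.1 + t *: real_row (edgevec c.2 i)) /\
  (forall c, c \in D -> ~ on_ridge u v c -> h + e <= ev u c.1 + ev v c.1).

Lemma small_cut_exists : exists2 e, 0 < e & small_cut e.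
Proof.
have [D1 D2 D3] := DD.
have [e1 e10 he1] : exists2 e : R, 0 < e & forall x : corner R n * 'I_n,
    x \in [seq (c, i) | c <- D, i <- enum 'I_n] ->
    exists2 d, d \in D & exists2 t, e < t & d.1 = x.1.1 + t *: real_row (edgevec x.1.2 x.2).
  apply: small_common_eps => [x e e' [d dD [t te dE]] _ e'e|x].
    by exists d => //; exists t => //; exact: le_lt_trans te.
  move=> /allpairsP[[c i] /= [cD _ ->]] /=; have [d dD [t t0 dE]] := D3 _ cD i.
  exists (t / 2); first by rewrite divr_gt0.
  by exists d => //; exists t => //; lra.
have [e2 e20 he2] : exists2 e : R, 0 < e & forall c, c \in D ->
    ~ on_ridge u v c -> h + e <= ev u c.1 + ev v c.1.
  apply: small_common_eps => [c e e' he _ e'e nr|c cD].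
    by apply: le_trans (he nr); rewrite lerD2l.
  have hu : ev u c0.1 <= ev u c.1 := D2 _ _ c0D cD i0.
  have hv : ev v c0.1 <= ev v c.1 := D2 _ _ c0D cD j0.
  have [ru|ru] := eqVneq (ev u c.1) (ev u c0.1); last first.
    by exists (ev u c.1 - ev u c0.1) => [|_]; [rewrite subr_gt0 lt_neqAle eq_sym ru|rewrite /h; lra].
  have [rv|rv] := eqVneq (ev v c.1) (ev v c0.1); last first.
    by exists (ev v c.1 - ev v c0.1) => [|_]; [rewrite subr_gt0 lt_neqAle eq_sym rv|rewrite /h; lra].
  exists 1 => // -[]; split.
    by apply: (normal_at_tight DD c0D cD _ ru); exists i0.
  by apply: (normal_at_tight DD c0D cD _ rv); exists j0.
exists (Num.min e1 e2); first by rewrite lt_min e10.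
split=> c cD => [i|nr].
  have [|d dD [t te dE]] := he1 (c, i).
    by apply/allpairsP; exists (c, i); rewrite mem_enum.
  by exists d => //; exists t => //; apply: le_lt_trans te; rewrite ge_min lexx.
apply: le_trans (he2 _ cD nr); rewrite lerD2l.
by rewrite ge_min lexx orbT.
Qed.

Variable e : R.
Hypotheses (e0 : 0 < e) (se : small_cut e).

(** The displaced point lies on a segment between two old vertices. *)
Lemma cut_ge c d i j : c \in D -> d \in D ->
  ev (normal c.2 j) c.1 <= ev (normal c.2 j) (d.1 + e *: real_row (edgevec d.2 i)).
Proof.
have [D1 D2 D3] := DD; move=> cD dD.
have [d' d'D [t te d'E]] := se.1 _ dD i.
have := D2 _ _ cD d'D j; have := D2 _ _ cD dD j; rewrite d'E !ev_step.
by move: (_%:~R) => z; have := e0; move: te; nra.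
Qed.

Lemma cut_gt c d i j : c \in D -> d \in D ->
  ev (normal c.2 j) c.1 < ev (normal c.2 j) d.1 ->
  ev (normal c.2 j) c.1 < ev (normal c.2 j) (d.1 + e *: real_row (edgevec d.2 i)).
Proof.
have [D1 D2 D3] := DD; move=> cD dD.
have [d' d'D [t te d'E]] := se.1 _ dD i.
have := D2 _ _ cD d'D j; rewrite d'E !ev_step.
by move: (_%:~R) => z; have := e0; move: te; nra.
Qed.

Lemma ridge_value c i j : c \in D -> ridge_pair u v c i j ->
  ev (normal c.2 i + normal c.2 j) (c.1 + e *: real_row (edgevec c.2 i)) = h + e.
Proof.
move=> cD rp; have ij := ridge_pair_neq rp; have [D1 _ _] := DD.
rewrite evDl !ev_step !zpair_dual ?D1 // eqxx eq_sym (negPf ij).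
rewrite mulr0 addr0 mulr1.
have uc : normal_at u c0 by exists i0.
have vc : normal_at v c0 by exists j0.
case: rp => -[iE jE]; rewrite iE jE /h.
  rewrite (facet_value cD c0D _ uc) ?(facet_value cD c0D _ vc); first by rewrite addrAC.
    by exists j.
  by exists i.
rewrite (facet_value cD c0D _ uc) ?(facet_value cD c0D _ vc); first lra.
  by exists i.
by exists j.
Qed.

Lemma truncate_points c' : c' \in truncate e u v D ->
  (forall c, c \in D -> forall i, ev (normal c.2 i) c.1 <= ev (normal c.2 i) c'.1) /\
  h + e <= ev (u + v) c'.1.
Proof.
have [D1 D2 D3] := DD.
move=> /truncateP[[c'D nr]|[c [i [j [cD rp ->]]]]].
  by split=> [c cD i|]; [exact: D2|rewrite evDl; exact: se.2].
split=> [d dD k|]; first exact: cut_ge.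
by rewrite -(ridge_sum rp) ridge_value.
Qed.

Lemma reach_edge (c r : corner R n) k : c.2 \in unitmx ->
  (forall l, l != k -> ev (normal c.2 l) r.1 = ev (normal c.2 l) c.1) ->
  ev (normal c.2 k) c.1 < ev (normal c.2 k) r.1 ->
  exists2 t, 0 < t & r.1 = c.1 + t *: real_row (edgevec c.2 k).
Proof.
move=> cu hl hk; exists (ev (normal c.2 k) r.1 - ev (normal c.2 k) c.1).
  by rewrite subr_gt0.
exact: step_along.
Qed.

(** If the far end of the edge is cut off, the edge now ends at the new vertex on it.
All normals at [c] except normal [k] are also normals at that far end, which
identifies the edge among those of the far end. *)
Lemma truncate_edge_kept c : c \in D -> ~ on_ridge u v c -> forall k,
  exists2 d, d \in truncate e u v D &
    exists2 t, 0 < t & d.1 = c.1 + t *: real_row (edgevec c.2 k).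
Proof.
have [D1 D2 D3] := DD; move=> cD nr k.
have cu := D1 _ cD; have [d dD [t t0 dE]] := D3 _ cD k.
have [rd|nd] := pselect (on_ridge u v d); last first.
  by exists d; [apply/truncateP; left|exists t].
have tight l : l != k -> ev (normal c.2 l) d.1 = ev (normal c.2 l) c.1.
  by move=> lk; rewrite dE ev_step zpair_dual // (negPf lk) mulr0 addr0.
(* Edge [k] leaves the ridge along the direction dual to the normal that is missing at [c]. *)
have [i [j [rp nci]]] : exists i j, ridge_pair u v d i j /\ ~ normal_at (normal d.2 i) c.
  have [[i iu] [j jv]] := rd.
  have [cu'|ncu] := pselect (normal_at u c).
    exists j, i; split; first by right.
    by rewrite jv => cv; apply: nr.
  by exists i, j; split; [left|rewrite iu].
exists (cut_corner e i j d); first by apply/truncateP; right; exists d, i, j.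
apply: reach_edge => //= [l lk|]; last first.
  apply: cut_gt => //; rewrite dE ev_step zpair_dual // eqxx mulr1 ltrDl //.
have [l' l'E] : normal_at (normal c.2 l) d.
  by exact: (normal_at_tight DD cD dD (ex_intro _ l erefl) (tight _ lk)).
rewrite ev_step tight // -l'E zpair_dual ?D1 //.
case: eqP => [l'i|_]; last by rewrite mulr0 addr0.
by case: nci; rewrite -l'i; exists l.
Qed.

(** The edge towards the other new vertex replaces edge [j], edge [i] continues to
the old neighbour, and the remaining edges run parallel to the ridge, to the new
vertex over the old neighbour. *)
Lemma truncate_edge_cut c i j : c \in D -> ridge_pair u v c i j -> forall k,
  exists2 d, d \in truncate e u v D &
    exists2 t, 0 < t &
      d.1 = (cut_corner e i j c).1 + t *: real_row (edgevec (cut_corner e i j c).2 k).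
Proof.
have [D1 D2 D3] := DD; move=> cD rp k; have ij := ridge_pair_neq rp.
have cu := D1 _ cD.
rewrite /= edgevec_shear //.
have [_|kj] := eqVneq k j.
  exists (cut_corner e j i c).
    by apply/truncateP; right; exists c, j, i; split=> //; exact: ridge_pairC.
  by exists e => //=; rewrite real_rowB scalerBr addrA addrAC addrK.
have [d dD [t te dE]] := se.1 _ cD k.
have tight l : l != k -> ev (normal c.2 l) d.1 = ev (normal c.2 l) c.1.
  by move=> lk; rewrite dE ev_step zpair_dual // (negPf lk) mulr0 addr0.
have t0 : 0 < t by apply: lt_trans te.
have [ki|ki] := eqVneq k i.
  exists d; last first.
    exists (t - e); first by rewrite subr_gt0.
    by rewrite dE ki -addrA -scalerDl [e + _]addrC subrK.
  apply/truncateP; left; split=> //.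
  have cui : ev (normal c.2 i) c.1 < ev (normal c.2 i) d.1.
    by rewrite dE ki ev_step zpair_dual // eqxx mulr1 ltrDl.
  move=> rd; have rc : normal_at (normal c.2 i) d.
    by case: rp => -[-> _]; case: rd.
  by move: cui; rewrite (@facet_value c d) ?ltxx //; exists i.
have normal_d l : l != k -> normal_at (normal c.2 l) d.
  by move=> lk; exact: (normal_at_tight DD cD dD (ex_intro _ l erefl) (tight _ lk)).
have [i' iE] : normal_at (normal c.2 i) d by apply: normal_d; rewrite eq_sym.
have [j' jE] : normal_at (normal c.2 j) d by apply: normal_d; rewrite eq_sym.
exists (cut_corner e i' j' d).
  by apply/truncateP; right; exists d, i', j'; split=> //; rewrite /ridge_pair iE jE.
apply: (@reach_edge ((cut_corner e i j c).1, c.2) (cut_corner e i' j' d)) => //= [l lk|].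
  rewrite !ev_step tight //; congr (_ + _ * _%:~R).
  have [l' l'E] := normal_d _ lk; rewrite zpair_dual // -l'E zpair_dual ?D1 //.
  congr (nat_of_bool _)%:R; apply/eqP/eqP => lE.
    by apply: (normal_inj cu); rewrite -l'E lE iE.
  by apply: (normal_inj (D1 _ dD)); rewrite l'E lE iE.
rewrite [ltLHS]ev_step zpair_dual // (negPf ki) mulr0 addr0.
by apply: cut_gt => //; rewrite dE ev_step zpair_dual // eqxx mulr1 ltrDl.
Qed.

(** Truncating a face of codimension two keeps a Delzant polytope Delzant. *)
Lemma truncate_fan_data : fan_data (truncate e u v D).
Proof.
have [D1 D2 D3] := DD; split.
- move=> c' /truncateP[[c'D _]|[c [i [j [cD rp ->]]]]]; first exact: D1.
  by apply: shear_unit; [exact: ridge_pair_neq rp|exact: D1].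
- move=> c' d' c'T /truncate_points[h1 h2] k.
  move: c'T => /truncateP[[c'D _]|[c [i [j [cD rp ->]]]]]; first exact: h1.
  rewrite /= normal_shear; have [_|ki] := eqVneq k i.
    by rewrite ridge_value // (ridge_sum rp).
  by rewrite ev_step zpair_dual ?D1 // (negPf ki) mulr0 addr0; exact: h1.
- move=> c' /truncateP[[c'D nr]|[c [i [j [cD rp ->]]]]] k.
    exact: truncate_edge_kept.
  exact: truncate_edge_cut.
Qed.

End Truncation.

(** * Making linear forms have constant sign on the normal cones *)

Section Elimination.
Context {R : realType} {n : nat}.

Implicit Types (D : seq (corner R n)) (c d : corner R n) (u v x y : 'cV[int]_n).
Implicit Types (m : 'rV[int]_n).

(** The pairs of adjacent facets whose normals have opposite strict signs on [m]. *)
Definition separated m D x y :=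
  exists2 c, c \in D &
    [/\ normal_at x c, normal_at y c, 0 < zpair x m & zpair y m < 0].

Definition sign_constant m D := forall x y, ~ separated m D x y.

Lemma normal_at_cut e u v c i j x : ridge_pair u v c i j ->
  normal_at x (cut_corner e i j c) -> x = u + v \/ exists2 k, k != i & normal c.2 k = x.
Proof.
move=> rp [k <-]; rewrite /= normal_shear; have [_|ki] := eqVneq k i.
  by left; rewrite (ridge_sum rp).
by right; exists k.
Qed.

(** The only new normal [u + v] lies in the old cone spanned by [u] and [v], where
[m] already had constant sign. *)
Lemma sign_constant_truncate e u v m D : sign_constant m D ->
  sign_constant m (truncate e u v D).
Proof.
move=> mD x y [c' /truncateP[[c'D nr]|[c [i [j [cD rp ->]]]]] [xc yc x0 y0]].
  by apply: (mD x y); exists c'.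
have [uc vc] : on_ridge u v c by apply/on_ridgeP; exists i, j.
move: (normal_at_cut rp xc) (normal_at_cut rp yc).
case=> [xE|[k ki kE]]; case=> [yE|[l li lE]].
- by move: x0 y0; rewrite xE yE; lia.
- have yc' : normal_at y c by exists l.
  move: x0; rewrite xE zpairDl => x0; have [u0|u0] := ltP 0 (zpair u m).
    by apply: (mD u y); exists c.
  by apply: (mD v y); exists c => //; split=> //; lia.
- have xc' : normal_at x c by exists k.
  move: y0; rewrite yE zpairDl => y0; have [u0|u0] := ltP (zpair u m) 0.
    by apply: (mD x u); exists c.
  by apply: (mD x v); exists c => //; split=> //; lia.
- by apply: (mD x y); exists c => //; split=> //; [exists k|exists l].
Qed.

(** Up to symmetry, a new pair consists of [u + v] and some [y] adjacent to both [u] and [v].  If [y]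
is negative on [m], the pair of [u] and [y] was separated, and by maximality the
value of [y] is at least that of [v].  As the value of [u + v] is smaller than
that of [u] by the absolute value of that of [v], the difference of the new pair
is at most the value of [u]. *)
Lemma truncate_separated e m D c0 i0 j0 :
  fan_data D -> c0 \in D ->
  let u := normal c0.2 i0 in let v := normal c0.2 j0 in
  0 < zpair u m -> zpair v m < 0 ->
  (forall x y, separated m D x y -> zpair x m - zpair y m <= zpair u m - zpair v m) ->
  forall x y, separated m (truncate e u v D) x y ->
    (separated m D x y /\ (x, y) <> (u, v)) \/
    zpair x m - zpair y m < zpair u m - zpair v m.
Proof.
move=> [D1 _ _] c0D u v u0 v0 smax x y.
move=> [c' /truncateP[[c'D nr]|[c [i [j [cD rp ->]]]]] [xc yc x0 y0]].
  left; split; first by exists c'.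
  by move=> [xu yv]; apply: nr; rewrite -xu -yv.
have [uc vc] : on_ridge u v c by apply/on_ridgeP; exists i, j.
move: (normal_at_cut rp xc) (normal_at_cut rp yc).
case=> [xE|[k ki kE]]; case=> [yE|[l li lE]].
- by move: x0 y0; rewrite xE yE; lia.
- have yc' : normal_at y c by exists l.
  have /smax : separated m D u y by exists c.
  by right; rewrite xE zpairDl; lia.
- have xc' : normal_at x c by exists k.
  have /smax : separated m D x v by exists c.
  by right; rewrite yE zpairDl; lia.
- left; split; first by exists c => //; split=> //; [exists k|exists l].
  move=> [xu yv]; case: rp => -[iE jE].
    by move/eqP: ki; apply; apply: (normal_inj (D1 _ cD)); rewrite kE iE.
  by move/eqP: li; apply; apply: (normal_inj (D1 _ cD)); rewrite lE iE.
Qed.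

Definition nonempty_data D := D != [::] /\ fan_data D.

Lemma truncate_neq0 e u v D : D != [::] -> truncate e u v D != [::].
Proof.
case: D => // c D _; have [rd|nr] := pselect (on_ridge u v c).
  have /on_ridgeP[i [j rp]] := rd.
  have : cut_corner e i j c \in truncate e u v (c :: D).
    by apply/truncateP; right; exists c, i, j; rewrite mem_head.
  by case: truncate.
have : c \in truncate e u v (c :: D) by apply/truncateP; left; rewrite mem_head.
by case: truncate.
Qed.

(** Induction on the bound, and then on the length of a list containing the pairs
that attain it: truncating at such a pair removes it and creates only pairs with
smaller difference. *)
Lemma make_sign_constant_bounded m (N : nat) D : nonempty_data D ->
  (forall x y, separated m D x y -> zpair x m - zpair y m <= N%:Z) ->
  exists D', [/\ nonempty_data D', sign_constant m D' &
    forall m', sign_constant m' D -> sign_constant m' D'].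
Proof.
elim: N D => [|N IHN] D ne bound.
  exists D; split=> // x y s; have := bound _ _ s.
  by case: s => c _ [_ _]; lia.
pose pairs : seq ('cV[int]_n * 'cV[int]_n) :=
  [seq (normal c.2 ij.1, normal c.2 ij.2) | c <- D, ij <- enum {: 'I_n * 'I_n}].
have : forall x y, separated m D x y -> zpair x m - zpair y m = N.+1%:Z -> (x, y) \in pairs.
  move=> x y [c cD [[i iE] [j jE] _ _]] _; apply/allpairsP; exists (c, (i, j)).
  by rewrite mem_enum /= iE jE.
move: pairs => pairs; have [k] := ubnP (size pairs).
elim: k pairs D ne bound => // k IHk pairs D ne bound spairs inpairs.
have [[x [y [sxy sumxy]]]|none] :=
    pselect (exists x y, separated m D x y /\ zpair x m - zpair y m = N.+1%:Z).
  have [neD DD] := ne.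
  have [c0 c0D [[i0 iE] [j0 jE] x0 y0]] := sxy.
  have ij0 : i0 != j0 by apply/eqP => ij; move: x0 y0; rewrite -iE -jE ij; lia.
  have [e e0 se] := small_cut_exists i0 j0 DD c0D.
  have T := truncate_fan_data DD c0D ij0 e0 se.
  have smax x' y' : separated m D x' y' ->
      zpair x' m - zpair y' m <= zpair x m - zpair y m.
    by rewrite sumxy; exact: bound.
  move: smax x0 y0; rewrite -iE -jE => smax x0 y0.
  have sT := truncate_separated (e := e) DD c0D x0 y0 smax.
  rewrite iE jE in T sT.
  have [||||D' [neD' mD' keep]] := IHk (rem (x, y) pairs) (truncate e x y D).
  - by split=> //; exact: truncate_neq0.
  - by move=> x' y' /sT[[/bound]//|]; rewrite sumxy; lia.
  - have := inpairs _ _ sxy sumxy; case: (pairs) spairs => // p ps sp pin.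
    by rewrite size_rem //; move: sp; rewrite /= ltnS.
  - move=> x' y' /sT[[s ne']|]; last by rewrite sumxy; lia.
    move=> /(inpairs _ _ s) h.
    rewrite -has_pred1 has_count count_mem_rem; case: eqP => [/esym//|_].
    by rewrite subn0 -has_count has_pred1.
  by exists D'; split=> // m' h; apply: keep; exact: sign_constant_truncate.
apply: IHN => // x y s; have := bound _ _ s; rewrite le_eqVlt => /orP[/eqP h|].
  by case: none; exists x, y.
lia.
Qed.

Lemma make_sign_constant m D : nonempty_data D ->
  exists D', [/\ nonempty_data D', sign_constant m D' &
    forall m', sign_constant m' D -> sign_constant m' D'].
Proof.
move=> ne.
(* A crude bound for the values of [m] on all normals. *)
pose N := (\sum_(c <- D) \sum_i `|zpair (normal c.2 i) m|)%N.
have bN x c : c \in D -> normal_at x c -> `|zpair x m| <= N%:Z.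
  move=> cD [i <-]; rewrite -abszE lez_nat /N (big_rem c) //= (bigD1 i) //=.
  by rewrite -addnA leq_addr.
apply: (@make_sign_constant_bounded m (N + N)) => // x y [c cD [xc yc _ _]].
have := bN _ _ cD xc; have := bN _ _ cD yc.
lia.
Qed.

Lemma make_all_sign_constant (ms : seq 'rV[int]_n) D : nonempty_data D ->
  exists D', nonempty_data D' /\ forall m, m \in ms -> sign_constant m D'.
Proof.
move=> ne; elim: ms => [|m ms [D' [ne' h]]]; first by exists D.
have [D'' [ne'' mD keep]] := make_sign_constant m ne'.
exists D''; split=> // m'; rewrite inE => /predU1P[->//|/h]; exact: keep.
Qed.

End Elimination.

Section Cube.
Context {R : realType} {n : nat}.
Implicit Types (f : {ffun 'I_n -> bool}).

Definition cube_normals f : 'M[int]_n := diag_mx (\row_i (-1) ^+ f i).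

Definition cube_corner f : 'rV[R]_n * 'M[int]_n :=
  (\row_i (f i)%:R, cube_normals f).

Definition cube_data := [seq cube_corner f | f <- enum {ffun 'I_n -> bool}].

Lemma cube_normals_sqr f : cube_normals f *m cube_normals f = 1%:M.
Proof.
rewrite /cube_normals mulmx_diag -diag_const_mx; congr diag_mx.
by apply/rowP => i; rewrite !mxE -expr2 sqrr_sign.
Qed.

Lemma cube_normals_unit f : cube_normals f \in unitmx.
Proof. by case: (mulmx1_unit (cube_normals_sqr f)). Qed.

Lemma cube_edgevec f i : edgevec (cube_normals f) i = (-1) ^+ f i *: delta_mx 0 i.
Proof.
have -> : edgevec (cube_normals f) i = row i (cube_normals f).
  rewrite /edgevec; congr row; apply: (can_inj (mulKmx (cube_normals_unit f))).
  by rewrite mulmxV ?cube_normals_unit // cube_normals_sqr.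
apply/rowP => j; rewrite !mxE eqxx /= [i == j]eq_sym.
by rewrite mulr_natr.
Qed.

Lemma ev_cube_normal f i (x : 'rV[R]_n) :
  ev (normal (cube_normals f) i) x = (-1) ^+ f i * x 0 i.
Proof.
rewrite ev_normal map_diag_mx mul_mx_diag !mxE.
by rewrite rmorph_sign mulrC.
Qed.

Lemma cube_fan_data : nonempty_data cube_data.
Proof.
split.
  have : cube_corner [ffun => false] \in cube_data.
    by apply/map_f; rewrite mem_enum.
  by case: cube_data.
split.
- by move=> _ /mapP[f _ ->]; exact: cube_normals_unit.
- move=> _ _ /mapP[f _ ->] /mapP[f' _ ->] i; rewrite !ev_cube_normal !mxE.
  by case: (f i); case: (f' i) => /=; rewrite ?expr1 ?expr0; lra.
- move=> _ /mapP[f _ ->] i.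
  exists (cube_corner [ffun j => (j == i) (+) f j]); first by apply/map_f; rewrite mem_enum.
  exists 1 => //; apply/rowP => j; rewrite cube_edgevec !mxE ffunE eqxx /=.
  rewrite mul1r; have [->|_] := eqVneq j i; last by rewrite mulr0 addr0.
  by case: (f i) => /=; rewrite ?expr1 ?expr0 mulr1 ?rmorphN1; lra.
Qed.

End Cube.

(** * Common refinements *)

Section CommonRefinement.
Context {R : realType} {n : nat}.

Implicit Types (D : seq (corner R n)) (c d : corner R n) (P Q : set 'rV[R]_n).

Definition corner_hull D : set 'rV[R]_n :=
  hull (fun i : 'I_(size D) => (tnth (in_tuple D) i).1).

Lemma corner_hull_point D c : c \in D -> corner_hull D c.1.
Proof.
move=> cD; have /tnthP[i ->] : c \in in_tuple D by [].
exact: (hull_vertex (fun i => (tnth (in_tuple D) i).1)).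
Qed.

Lemma corner_hull_polytope D : D != [::] -> polytope (corner_hull D).
Proof.
case: D => // c D _.
exact: (hull_polytope (fun i : 'I_(size (c :: D)) => (tnth (in_tuple (c :: D)) i).1) ord0).
Qed.

Lemma corner_hull_chart D d : fan_data D -> d \in D -> chart (corner_hull D) d.1 d.2.
Proof.
move=> [D1 D2 D3] dD; split; first exact: D1.
  split=> [|i x]; first exact: corner_hull_point.
  by apply: hull_pairing => j; apply: D2 => //; exact: mem_tnth.
move=> i; have [e eD [t t0 eE]] := D3 _ dD i; exists t => //.
by rewrite -eE; exact: corner_hull_point.
Qed.

Lemma corner_hull_charts D (f : 'cV[R]_n) : nonempty_data D ->
  exists2 d, d \in D & forall i, 0 <= pairing f (real_row (edgevec d.2 i)).
Proof.
move=> [neD [D1 D2 D3]].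
have [i0 _] : exists i : 'I_(size D), true by case: D neD {D1 D2 D3} => // c D _; exists ord0.
have [i _ imin] := @arg_minP _ _ _ i0 xpredT
  (fun i => pairing f (tnth (in_tuple D) i).1) isT.
exists (tnth (in_tuple D) i) => [|k]; first exact: mem_tnth.
have [e eD [t t0 eE]] := D3 _ (mem_tnth i (in_tuple D)) k.
have /tnthP[j je] : e \in in_tuple D by [].
have := imin j isT; rewrite -je eE pairingD pairingZ.
by rewrite lerDl pmulr_rge0.
Qed.

Lemma corner_hull_charted D : nonempty_data D -> charted (corner_hull D).
Proof.
move=> ne; split; first by apply: corner_hull_polytope; case: ne.
move=> f; have [d dD d0] := corner_hull_charts f ne.
by exists d.1, d.2; split=> //; apply: corner_hull_chart => //; case: ne.
Qed.

(** Let [s] be the sum of the normals at a vertex of the new polytope, and let [e] be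
a vertex of [P] where [s] is minimal.  On an edge vector at [e] the form [s] is
non-negative and its summands have the same sign, so all the summands are
non-negative and are minimal at [e] too. *)
Lemma sign_constant_refines D P (L : seq (corner R n)) : nonempty_data D ->
  (forall d, d \in L -> chart P d.1 d.2) ->
  (forall f : 'cV[R]_n, exists2 d, d \in L & forall i, 0 <= pairing f (real_row (edgevec d.2 i))) ->
  (forall d i, d \in L -> sign_constant (edgevec d.2 i) D) ->
  fan_refines (corner_hull D) P.
Proof.
move=> ne chartL coverL signL; split; first exact: corner_hull_charted.
have [_ DD] := ne; have [D1 D2 D3] := DD.
move=> p U [Uu [Pp plow] nbr].
pose f : 'cV[R]_n := \sum_i map_mx intr (normal U i).
have [d dD d0] := corner_hull_charts f ne.
have [du [dP dlow] dnbr] := corner_hull_chart DD dD.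
have dp i : ev (normal U i) d.1 = ev (normal U i) p.
  have := lowest_pairing du (conj dP dlow) d0 Pp.
  rewrite /f !pairing_suml -subr_le0 -sumrB le_eqVlt ltNge sumr_ge0 => [|j _]; last first.
    by rewrite subr_ge0; exact: plow.
  rewrite orbF psumr_eq0 => [/allP/(_ i (mem_index_enum _))|j _].
    by rewrite /= subr_eq0 => /eqP.
  by rewrite subr_ge0; exact: plow.
pose s : 'cV[R]_n := \sum_k map_mx intr (normal d.2 k).
have [e eL e0] := coverL s.
have [eu elow _] := chartL _ eL.
exists e.1.
have dlowP k x : P x -> ev (normal d.2 k) e.1 <= ev (normal d.2 k) x.
  apply: (lowest_pairing eu elow) => l.
  rewrite -/(ev _ _) ev_real_row ler0z leNgt; apply/negP => neg.
  have := e0 l; rewrite /s pairing_suml leNgt => /negP; apply.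
  have le0 j : ev (normal d.2 j) (real_row (edgevec e.2 l)) <= 0 :> R.
    rewrite ev_real_row lerz0 leNgt; apply/negP => pos.
    apply: (signL e l eL (normal d.2 j) (normal d.2 k)).
    by exists d => //; split=> //; [exists j|exists k].
  rewrite (bigD1 k) //=; rewrite -[ltRHS]addr0; apply: ltr_leD.
    by rewrite -/(ev _ _) ev_real_row ltrz0.
  by apply: sumr_le0 => j _; exact: le0.
split=> [|i x Px]; first by case: elow.
rewrite -subr_ge0 -evB /ev (pairing_chart _ _ du); apply: sumr_ge0 => k _.
apply: mulr_ge0; first by rewrite evB subr_ge0 dlowP.
have [t t0 /(plow i)] := dnbr k.
by rewrite evD dp lerDl /ev pairingZ pmulr_rge0.
Qed.

(** Finitely many charts, hence finitely many edge vectors, determine the fans of the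
given polytopes. *)
Lemma common_refinement (Ps : seq (set 'rV[R]_n)) :
  (forall P, List.In P Ps -> is_delzant P) ->
  exists S, charted S /\ forall P, List.In P Ps -> fan_refines S P.
Proof.
move=> dP.
(* The list [M] collects the edge vectors of charts covering the dual space. *)
suff [M hM] : exists M : seq 'rV[int]_n, forall D, nonempty_data D ->
    (forall m, m \in M -> sign_constant m D) ->
    forall P, List.In P Ps -> fan_refines (corner_hull D) P.
  have [D [ne hD]] := make_all_sign_constant M (@cube_fan_data R n).
  exists (corner_hull D); split; first exact: corner_hull_charted.
  exact: hM.
elim: Ps dP => [|P Ps IH] dP; first by exists [::].
have [|M hM] := IH; first by move=> Q PQ; apply: dP; right.
have [L [chartL coverL]] := delzant_chart_list (dP P (or_introl erefl)).
exists ([seq edgevec d.2 i | d <- L, i <- enum 'I_n] ++ M) => D ne hD Q [<-|PQ].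
  apply: (sign_constant_refines ne chartL coverL) => d i dL; apply: hD.
  by rewrite mem_cat; apply/orP; left; apply/allpairsP; exists (d, i); rewrite mem_enum.
by apply: hM => // m mM; apply: hD; rewrite mem_cat mM orbT.
Qed.

End CommonRefinement.

(** * Hausdorff continuity of Minkowski combinations *)

Section EuclideanDistance.
Context {R : realType} {n : nat}.
Implicit Types (p q x y : 'rV[R]_n).

Lemma euclidean_dist_ge0 p q : 0 <= euclidean_dist p q.
Proof. exact: sqrtr_ge0. Qed.

Lemma euclidean_dist_scaled t x y p q : x - y = t *: (p - q) ->
  euclidean_dist x y = `|t| * euclidean_dist p q.
Proof.
move=> e; rewrite /euclidean_dist -sqrtr_sqr -sqrtrM ?sqr_ge0 //; congr Num.sqrt.
rewrite mulr_sumr; apply: eq_bigr => i _; rewrite -exprMn; congr (_ ^+ 2).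
by have := congr1 (fun z : 'rV[R]_n => z 0 i) e; rewrite !mxE.
Qed.

Lemma euclidean_dist_mcomb s s' p q p' q' : 0 <= s' <= 1 ->
  euclidean_dist ((1 - s) *: p + s *: q) ((1 - s') *: p' + s' *: q') <=
  `|s - s'| * euclidean_dist p q + euclidean_dist p p' + euclidean_dist q q'.
Proof.
move=> /andP[s0 s1].
apply: le_trans (euclidean_dist_triangle _ ((1 - s') *: p' + s' *: q) _) _.
apply: lerD; last first.
  rewrite (@euclidean_dist_scaled s' _ _ q q') ?ger0_norm //.
    by rewrite ler_piMl // euclidean_dist_ge0.
  by rewrite opprD addrACA subrr add0r scalerBr.
apply: le_trans (euclidean_dist_triangle _ ((1 - s') *: p + s' *: q) _) _.
apply: lerD.
  rewrite (@euclidean_dist_scaled (s' - s) _ _ p q) 1?distrC //.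
  by apply/rowP => i; rewrite !mxE; ring.
rewrite (@euclidean_dist_scaled (1 - s') _ _ p p') ?ger0_norm ?subr_ge0 //.
  by rewrite ler_piMl ?euclidean_dist_ge0 // gerBl.
by apply/rowP => i; rewrite !mxE; ring.
Qed.

Lemma polytope_bounded P : polytope P ->
  exists M : R, forall x, P x -> euclidean_dist x 0 <= M.
Proof.
move=> /polytopeP[I [a [i0 ->]]].
exists (\sum_i euclidean_dist (a i) 0) => x [w [w0 w1 ->]].
apply: (@le_trans _ _ (\sum_i w i * euclidean_dist (a i) 0)).
  elim/big_rec2: _ => [|i r y _ le]; first by rewrite euclidean_distxx.
  apply: le_trans (euclidean_dist_triangle _ y _) _; apply: lerD => //.
  rewrite (@euclidean_dist_scaled (w i) _ _ (a i) 0) ?ger0_norm //.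
  by rewrite addrK subr0.
apply: ler_sum => i _; rewrite ler_piMl ?euclidean_dist_ge0 // -w1.
by rewrite (bigD1 i) //= lerDl sumr_ge0.
Qed.

End EuclideanDistance.

Section HausdorffContinuity.
Context {R : realType} {n : nat}.
Implicit Types (P Q : set 'rV[R]_n) (p q x y : 'rV[R]_n).

Definition hausdorff_close (e : R) P Q :=
  (forall p, P p -> exists2 q, Q q & euclidean_dist p q < e) /\
  (forall q, Q q -> exists2 p, P p & euclidean_dist q p < e).

Definition hausdorff_continuous (T : topologicalType) (F : T -> set 'rV[R]_n) :=
  forall z0 e, 0 < e -> \forall z \near z0, hausdorff_close e (F z0) (F z).

Lemma delzant_ball_close (e : R) (P Q : delzant R n) :
  ball P e Q -> hausdorff_close e P Q.
Proof.
move=> PQ; have e0 : 0 < e := delzant_ball_gt0 PQ.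
have [r [re h h']] := (hausdorff_dist_ltP P Q e0).1 PQ.
by split=> x => [/h|/h'] [y Qy xy]; exists y => //; exact: le_lt_trans re.
Qed.

Lemma close_delzant_ball (e : R) (P Q : delzant R n) : 0 < e ->
  hausdorff_close (e / 2) P Q -> ball P e Q.
Proof.
move=> e0 [h h']; apply/(hausdorff_dist_ltP P Q e0); exists (e / 2); split.
- by rewrite ltr_pdivrMr // ltr_pMr // ltr1n.
- by move=> p /h[q Qq pq]; exists q => //; exact: ltW.
- by move=> p /h'[q Qq pq]; exists q => //; exact: ltW.
Qed.

Lemma continuous_hausdorff (T : topologicalType) (f : T -> delzant R n) :
  continuous f -> hausdorff_continuous (fun z => delzant_set (f z)).
Proof.
move=> cf z0 e e0; have /cvg_ballP/(_ e e0) := cf z0.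
by apply: filterS => z; exact: delzant_ball_close.
Qed.

Lemma hausdorff_continuous_delzant (T : topologicalType) (f : T -> delzant R n) :
  hausdorff_continuous (fun z => delzant_set (f z)) -> continuous f.
Proof.
move=> cf z0; apply/cvg_ballP => e e0; have := cf z0 (e / 2) (divr_gt0 e0 (ltr0Sn R 1)).
by apply: filterS => z; exact: close_delzant_ball.
Qed.

(** A change of the weights moves a combination of two points by at most the change
times their distance, which is bounded on polytopes. *)
Lemma hausdorff_continuous_mcomb (T : topologicalType) (s : T -> R)
    (F G : T -> set 'rV[R]_n) :
  continuous (s : T -> R^o) -> (forall z, 0 <= s z <= 1) ->
  (forall z, polytope (F z)) -> (forall z, polytope (G z)) ->
  hausdorff_continuous F -> hausdorff_continuous G ->
  hausdorff_continuous (fun z => mcomb (s z) (F z) (G z)).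
Proof.
move=> cs s01 polF polG cF cG z0 e e0.
have [M1 hM1] := polytope_bounded (polF z0).
have [M2 hM2] := polytope_bounded (polG z0).
pose M := `|M1 + M2| + 1; have M0 : 0 < M by rewrite ltr_pwDr.
have dM p q : F z0 p -> G z0 q -> euclidean_dist p q <= M.
  move=> /hM1 pM /hM2 qM; apply: le_trans (euclidean_dist_triangle _ 0 _) _.
  rewrite [euclidean_dist 0 q]euclidean_distC; apply: le_trans (lerD pM qM) _.
  by apply: le_trans (ler_norm _) _; rewrite lerDl.
have e30 : 0 < e / 3 by rewrite divr_gt0.
have eM0 : 0 < e / 3 / M by rewrite divr_gt0.
have near_s : \forall z \near z0, `|s z0 - s z| < e / 3 / M.
  by have /cvgrPdist_lt/(_ _ eM0) := cs z0; apply.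
have sum3 a b c : a < e / 3 -> b < e / 3 -> c < e / 3 -> a + b + c < e by lra.
have sM z p q : `|s z0 - s z| < e / 3 / M -> F z0 p -> G z0 q ->
    `|s z0 - s z| * euclidean_dist p q < e / 3.
  move=> sz Fp Gq; apply: (@le_lt_trans _ _ (`|s z0 - s z| * M)).
    by rewrite ler_wpM2l // dM.
  by rewrite -ltr_pdivlMr.
near=> z.
have zs : `|s z0 - s z| < e / 3 / M by near: z.
have [F1 F2] : hausdorff_close (e / 3) (F z0) (F z) by near: z; exact: cF.
have [G1 G2] : hausdorff_close (e / 3) (G z0) (G z) by near: z; exact: cG.
split=> [_ [p [q [Fp Gq ->]]]|_ [p' [q' [Fp' Gq' ->]]]].
  have [p' Fp' pp'] := F1 _ Fp; have [q' Gq' qq'] := G1 _ Gq.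
  exists ((1 - s z) *: p' + s z *: q'); first by exists p', q'.
  apply: le_lt_trans (euclidean_dist_mcomb _ _ _ _ _ (s01 z)) _.
  by apply: sum3 => //; exact: sM.
have [p Fp pp'] := F2 _ Fp'; have [q Gq qq'] := G2 _ Gq'.
exists ((1 - s z0) *: p + s z0 *: q); first by exists p, q.
rewrite euclidean_distC.
apply: le_lt_trans (euclidean_dist_mcomb _ _ _ _ _ (s01 z)) _.
by apply: sum3; [exact: sM|rewrite euclidean_distC|rewrite euclidean_distC].
Unshelve. all: by end_near. Qed.

Lemma hausdorff_continuous_cst (T : topologicalType) P :
  hausdorff_continuous (fun _ : T => P).
Proof.
move=> z0 e e0; apply: nearW => _; split=> x Px; exists x => //;
  by rewrite euclidean_distxx.
Qed.

End HausdorffContinuity.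

(** * The null-homotopy *)

Section RealMaps.
Context {R : realType} {T : topologicalType}.
Implicit Types (f g : T -> R).

Definition clamp (x : R) : R := Num.max 0 (Num.min 1 x).

Lemma clamp01 x : 0 <= clamp x <= 1.
Proof. by rewrite /clamp le_max lexx ge_max ler01 ge_min lexx. Qed.

Lemma clamp_id x : 0 <= x <= 1 -> clamp x = x.
Proof. by move=> /andP[x0 x1]; rewrite /clamp (min_idPr x1) (max_idPr x0). Qed.

Lemma clamp_le0 x : x <= 0 -> clamp x = 0.
Proof.
by move=> x0; rewrite /clamp; apply/max_idPl; rewrite ge_min x0 orbT.
Qed.

Lemma clamp_ge1 x : 1 <= x -> clamp x = 1.
Proof. by move=> x1; rewrite /clamp (min_idPl x1); exact: (max_idPr ler01). Qed.

Lemma continuous_addr f g : continuous f -> continuous g ->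
  continuous (fun z => f z + g z).
Proof. by move=> cf cg z; apply: cvgD; [exact: cf|exact: cg]. Qed.

Lemma continuous_mulr f g : continuous f -> continuous g ->
  continuous (fun z => f z * g z).
Proof. by move=> cf cg z; apply: cvgM; [exact: cf|exact: cg]. Qed.

Lemma continuous_cstr (k : R) : continuous (fun _ : T => k).
Proof. by move=> z; exact: cvg_cst. Qed.

Lemma continuous_subr f g : continuous f -> continuous g ->
  continuous (fun z => f z - g z).
Proof. by move=> cf cg z; apply: cvgB; [exact: cf|exact: cg]. Qed.

Lemma continuous_clamp f : continuous f -> continuous (fun z => clamp (f z)).
Proof.
move=> cf z; apply: (@continuous_max R T (cst 0) (fun z => Num.min 1 (f z)) z).
  exact: cvg_cst.
by apply: (@continuous_min R T (cst 1) f z); [exact: cvg_cst|exact: cf].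
Qed.

End RealMaps.

Lemma clamp_le (R : realType) (x y : R) : x <= y -> clamp x <= clamp y.
Proof. by move=> xy; rewrite /clamp le_max2 // le_min2. Qed.

Lemma continuous_fst (S T : topologicalType) : continuous (@fst S T).
Proof. by move=> z; exact: cvg_fst. Qed.

Lemma continuous_snd (S T : topologicalType) : continuous (@snd S T).
Proof. by move=> z; exact: cvg_snd. Qed.

Ltac continuity := repeat first
  [ exact: continuous_cstr | exact: continuous_fst | exact: continuous_snd
  | apply: continuous_clamp | apply: continuous_subr | apply: continuous_addr
  | apply: continuous_mulr ].

Section DelzantMaps.
Context {R : realType} {n : nat}.
Implicit Types (P Q d : delzant R n).

Lemma delzant_inj P Q : delzant_set P = delzant_set Q -> P = Q.
Proof.
case: P Q => [P hP] [Q hQ] /= e; case: _ / e in hQ *; congr Delzant.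
exact: Prop_irrelevance.
Qed.

(** The polytope [d] is a default value: constructions are done with sets and lifted
to the space of Delzant polytopes afterwards. *)
Definition to_delzant d (P : set 'rV[R]_n) : delzant R n :=
  if pselect (is_delzant P) is left h then Delzant h else d.

Lemma to_delzantK d (A : set 'rV[R]_n) : is_delzant A ->
  delzant_set (to_delzant d A) = A.
Proof. by rewrite /to_delzant; case: pselect. Qed.

Lemma to_delzant_set d (P : delzant R n) (A : set 'rV[R]_n) : A = P ->
  to_delzant d A = P.
Proof. by move=> ->; apply: delzant_inj; apply: to_delzantK; exact: delzantP. Qed.

Lemma delzant_polytope P : polytope P.
Proof. by case: (delzantP P) => -[]. Qed.

Lemma delzant_neq0 P : delzant_set P !=set0.
Proof. by case: (delzant_polytope P). Qed.

Lemma to_delzant_continuous (T : topologicalType) d (F : T -> set 'rV[R]_n) :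
  (forall z, is_delzant (F z)) -> hausdorff_continuous F ->
  continuous (fun z => to_delzant d (F z)).
Proof.
move=> dF cF; apply: hausdorff_continuous_delzant.
suff -> : (fun z => delzant_set (to_delzant d (F z))) = F by [].
by apply/funext => z; exact: to_delzantK.
Qed.

Lemma mcomb_delzant s (P : set 'rV[R]_n) Q : 0 <= s <= 1 -> fan_refines P Q ->
  is_delzant (mcomb s P Q).
Proof.
move=> /andP[s0]; rewrite le_eqVlt => /predU1P[->|s1] PQ.
  rewrite mcomb1; first exact: delzantP.
  by case: PQ => -[[]].
apply: charted_delzant; apply: fan_refines_mcomb_charted PQ; rewrite ?s0 //.
exact: delzant_polytope.
Qed.

End DelzantMaps.

Section Straightening.
Context {R : realType} {n : nat} (g : R -> delzant R n).
Hypothesis cg : continuous g.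
Implicit Types (a b c s t : R).

(** The piece of [g] on [a, b] is homotopic, with fixed ends, to a path all of whose
fans are refined as soon as the fans of the finitely many polytopes in [L] are. *)
Definition straightened a b := exists (L : seq (delzant R n)) (G : R * R -> delzant R n),
  [/\ continuous G,
      forall t, a <= t <= b -> G (0, t) = g t,
      forall s, G (s, a) = g a /\ G (s, b) = g b &
      forall S, (forall P, List.In P L -> fan_refines S P) ->
        forall t, a <= t <= b -> fan_refines S (G (1, t))].

Lemma straightened_refl a : straightened a a.
Proof.
exists [:: g a], (fun _ => g a); split=> //.
- by move=> z; exact: cvg_cst.
- by move=> t /andP[h1 h2]; congr g; apply: le_anti; rewrite h1.
- by move=> S /(_ (g a)) h t _; apply: h; left.
Qed.

Lemma straightened_trans a b c : a <= b -> b <= c ->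
  straightened a b -> straightened b c -> straightened a c.
Proof.
move=> ab bc [L1 [G1 [c1 start1 side1 end1]]] [L2 [G2 [c2 start2 side2 end2]]].
pose G z := if z.2 <= b then G1 z else G2 z.
have glue s : G1 (s, b) = G2 (s, b) by rewrite (side1 s).2 (side2 s).1.
exists (L1 ++ L2), G; split.
- move=> [s t]; have [tb|tb|tb] := ltgtP t b.
  + have e : \forall z \near (s, t), G1 z = G z.
      have : \forall z \near (s, t), z.2 < b.
        exact: (@continuous_snd R R (s, t) [set x | x < b] (lt_nbhsl tb)).
      by apply: filterS => z zb; rewrite /G ltW.
    rewrite /continuous_at {2}/G /= ltW //.
    by apply: cvg_trans (near_eq_cvg e) _; exact: c1.
  + have e : \forall z \near (s, t), G2 z = G z.
      have : \forall z \near (s, t), b < z.2.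
        exact: (@continuous_snd R R (s, t) [set x | b < x] (lt_nbhsr tb)).
      by apply: filterS => z zb; rewrite /G leNgt zb.
    rewrite /continuous_at {2}/G /= leNgt tb /=.
    by apply: cvg_trans (near_eq_cvg e) _; exact: c2.
  + rewrite tb => A; rewrite {1}/G /= lexx => nA.
    have n1 : \forall z \near (s, b), A (G1 z) by exact: c1.
    have n2 : \forall z \near (s, b), A (G2 z) by apply: c2; rewrite -glue.
    by apply: filterS2 n1 n2 => z A1 A2; rewrite /= /G; case: ifP.
- move=> t /andP[ta tc]; rewrite /G /=; case: (leP t b) => tb.
    by rewrite start1 // ta.
  by rewrite start2 // tc ltW.
- move=> s; rewrite /G /= ab (side1 s).1; split=> //.
  have [cb|_] := leP c b; last exact: (side2 s).2.
  have -> : c = b by apply: le_anti; rewrite cb.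
  exact: (side1 s).2.
- move=> S hS t /andP[ta tc]; rewrite /G /=; case: (leP t b) => tb.
    by apply: end1; rewrite ?ta // => P PL; apply: hS; apply: List.in_or_app; left.
  apply: end2; rewrite ?(ltW tb) // => P PL.
  by apply: hS; apply: List.in_or_app; right.
Qed.

(** At the end of the homotopy the path runs linearly from [g a] to [P] on the first
third of the interval, rests at [P], and runs linearly to [g b] on the last
third.  The weight [beta] of [P] rises to this profile, while [phi]
reparametrises [g] so that at the end it is constant where the weight is not 1. *)
Lemma straightened_local a b (P : delzant R n) : a <= b ->
  (forall t, a <= t <= b -> fan_refines (g t) P) -> straightened a b.
Proof.
rewrite le_eqVlt => /predU1P[->|ab ref]; first by move=> _; exact: straightened_refl.
have ba0 : 0 < b - a by rewrite subr_gt0.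
pose sigma (z : R * R) := clamp z.1.
pose u (z : R * R) := clamp ((z.2 - a) * (b - a)^-1).
pose beta z := sigma z * (clamp (3 * u z) - clamp (3 * u z - 2)).
pose nu z := (1 - sigma z) * u z + sigma z * clamp (3 * u z - 1).
pose phi z := a + (b - a) * nu z.
have beta01 z : 0 <= beta z <= 1.
  have /andP[s0 s1] := clamp01 z.1; have /andP[_ k1] := clamp01 (3 * u z).
  have /andP[k0 _] := clamp01 (3 * u z - 2).
  have k2 : clamp (3 * u z - 2) <= clamp (3 * u z) by apply: clamp_le; lra.
  by rewrite /beta /sigma; apply/andP; split; nra.
have phiab z : a <= phi z <= b.
  have /andP[? ?] := clamp01 z.1; have /andP[? ?] := clamp01 ((z.2 - a) * (b - a)^-1).
  have /andP[? ?] := clamp01 (3 * u z - 1).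
  have nu0 : 0 <= nu z by rewrite addr_ge0 // mulr_ge0 // subr_ge0.
  have nu1 : nu z <= 1 by rewrite /nu /sigma /u; nra.
  by rewrite /phi; apply/andP; split; nra.
pose F z := mcomb (beta z) (g (phi z)) P.
have dF z : is_delzant (F z) by apply: mcomb_delzant => //; exact: ref.
have cphi : continuous phi by rewrite /phi /nu /sigma /u; continuity.
have cF : hausdorff_continuous F.
  apply: hausdorff_continuous_mcomb => //.
  - by rewrite /beta /sigma /u; continuity.
  - by move=> z; exact: delzant_polytope.
  - by move=> z; exact: delzant_polytope.
  - apply: continuous_hausdorff => z; apply: continuous_comp; first exact: cphi.
    exact: cg.
  - exact: hausdorff_continuous_cst.
exists [:: g a; g b; P], (fun z => to_delzant P (F z)); split.
- exact: to_delzant_continuous.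
- move=> t tab; apply: to_delzant_set; rewrite /F.
  have s0 : sigma (0, t) = 0 by exact: clamp_le0.
  have ut : u (0, t) = (t - a) * (b - a)^-1.
    rewrite /u /= clamp_id // -/(_ / _) ler_pdivrMr // ler_pdivlMr //.
    by move: tab; lra.
  rewrite /beta s0 mul0r mcomb0; last exact: delzant_neq0.
  by rewrite /phi /nu s0 ut mul0r addr0 subr0 mul1r mulrC mulfVK ?lt0r_neq0 // addrC subrK.
- move=> s; split; apply: to_delzant_set; rewrite /F.
    have u0 : u (s, a) = 0 by rewrite /u /= subrr mul0r clamp_id // lexx ler01.
    have c0 x : x <= 0 -> clamp (3 * u (s, a) + x) = 0 :> R.
      by move=> x0; rewrite u0 mulr0 add0r clamp_le0.
    have -> : beta (s, a) = 0.
      by rewrite /beta -[in clamp (3 * _)](addr0 (3 * _)) !c0 ?subrr ?mulr0 //; lra.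
    rewrite /phi /nu c0; last lra.
    by rewrite u0 !mulr0 addr0 mulr0 addr0 mcomb0 //; exact: delzant_neq0.
  have u1 : u (s, b) = 1.
    by rewrite /u /= mulfV ?lt0r_neq0 // clamp_id // lexx ler01.
  have c1 x : -2 <= x -> clamp (3 * u (s, b) + x) = 1 :> R.
    by move=> x0; rewrite u1 mulr1 clamp_ge1 //; lra.
  have -> : beta (s, b) = 0.
    by rewrite /beta -[in clamp (3 * _)](addr0 (3 * _)) !c1 ?subrr ?mulr0 //; lra.
  rewrite /phi /nu c1; last lra.
  rewrite u1 !mulr1 subrK mulr1 mcomb0; last exact: delzant_neq0.
  by rewrite addrC subrK.
- move=> S hS t _; rewrite to_delzantK //.
  have hSP : fan_refines S P by apply: hS; right; right; left.
  have s1 : sigma (1, t) = 1 by exact: clamp_ge1.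
  have [u1|u1] := leP (u (1, t)) (1 / 3).
    have -> : F (1, t) = mcomb (beta (1, t)) (g a) P.
      rewrite /F /phi /nu s1 subrr mul0r add0r mul1r clamp_le0; last lra.
      by rewrite mulr0 addr0.
    by apply: fan_refines_mcomb => //; apply: hS; left.
  have [u2|u2] := leP (2 / 3) (u (1, t)).
    have -> : F (1, t) = mcomb (beta (1, t)) (g b) P.
      rewrite /F /phi /nu s1 subrr mul0r add0r mul1r clamp_ge1; last lra.
      by rewrite mulr1 addrC subrK.
    by apply: fan_refines_mcomb => //; apply: hS; right; left.
  have -> : F (1, t) = P; last by [].
  have b1 : beta (1, t) = 1.
    rewrite /beta s1 mul1r [clamp (3 * _)]clamp_ge1; last lra.
    by rewrite clamp_le0 ?subr0 //; lra.
  by rewrite /F b1 mcomb1 //; exact: delzant_neq0.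
Qed.

(** The supremum of the end points that can be reached is attained and equals 1: a
piece around it can be appended by local refinement. *)
Lemma straightened_unit_interval :
  (forall t0, 0 <= t0 <= 1 -> exists2 e, 0 < e &
     forall t, 0 <= t <= 1 -> `|t - t0| <= e -> fan_refines (g t) (g t0)) ->
  straightened 0 1.
Proof.
move=> local; pose A := [set b | 0 <= b <= 1 /\ straightened 0 b].
have A0 : A 0 by split; [rewrite lexx ler01|exact: straightened_refl].
have supA : has_sup A.
  by split; [exists 0|exists 1 => b [/andP[]]].
have s0 : 0 <= sup A by apply: sup_upper_bound.
have s1 : sup A <= 1 by apply: ge_sup => [|b [/andP[]]//]; exists 0.
have [|e e0 he] := local (sup A); first by rewrite s0.
have [a [/andP[a0 a1] fa] ea] := sup_adherent e0 supA.
have as' : a <= sup A by apply: sup_upper_bound => //; split=> //; rewrite a0.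
(* Unless it is 1, the point [c] of [A] lies beyond the supremum. *)
pose c := Num.min 1 (sup A + e).
have c1 : c <= 1 by rewrite ge_min lexx.
have cs : c <= sup A + e by rewrite ge_min lexx orbT.
have sc : sup A <= c by rewrite le_min s1 lerDl ltW.
have fc : straightened 0 c.
  apply: (straightened_trans a0 _ fa); first exact: le_trans sc.
  apply: (@straightened_local _ _ (g (sup A))); first exact: le_trans sc.
  move=> t /andP[ta tc]; apply: he; first by rewrite (le_trans a0) // (le_trans tc).
  by rewrite ler_distl; apply/andP; split; lra.
have : c <= sup A.
  apply: sup_upper_bound => //; split=> //.
  by rewrite c1 (le_trans s0).
have [c1'|] := leP 1 (sup A + e); last first.
  by rewrite /c => h; rewrite (min_idPr (ltW h)); lra.
by move: fc; rewrite /c (min_idPl c1').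
Qed.

End Straightening.

(** Freezing a path outside the unit interval makes it continuous on the whole line,
so that no subspace topologies are needed in the constructions. *)
Lemma continuous_clamped_path (R : realType) (T : topologicalType) (g : R -> T) :
  is_path g -> continuous (g \o clamp).
Proof.
move=> /subspace_continuousP gc t.
have t01 : `[0, 1]%classic (clamp t) by rewrite /= in_itv /= clamp01.
apply: cvg_comp; last exact: gc t01.
move=> A wA; have ct : continuous (@clamp R) by apply: (@continuous_clamp R R id) => z; exact: cvg_id.
have : \forall s \near t, `[0, 1]%classic (clamp s) -> A (clamp s) by exact: (ct t) wA.
by apply: filterS => s; apply; rewrite /= in_itv /= clamp01.
Qed.

Lemma clamp_closed_path (R : realType) (T : topologicalType) (g : R -> T) t :
  0 <= t <= 1 -> (g \o clamp) t = g t.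
Proof. by move=> t01; rewrite /= clamp_id. Qed.

(** For [s] in the first half of the unit interval the straightening homotopy [G] is
performed; in the second half the weight [delta] of the base point grows to 1.
The weight [kappa] of [S] is positive exactly in the interior of the second half,
where combinations of the straightened loop with the base point have to be made
Delzant. *)
Lemma straightened_null_homotopic (R : realType) (n : nat) (g : R -> delzant R n) :
  g 0 = g 1 -> straightened (g \o clamp) 0 1 -> null_homotopic g.
Proof.
move=> loop [L [G [cG G0 Gside Gend]]].
have zero01 : 0 <= (0 : R) <= 1 by rewrite lexx ler01.
have one01 : 0 <= (1 : R) <= 1 by rewrite lexx ler01.
have side0 s : G (s, 0) = g 0 by rewrite (Gside s).1 clamp_closed_path.
have side1 s : G (s, 1) = g 0 by rewrite (Gside s).2 clamp_closed_path.
have [|S [cS hS]] := @common_refinement R n (List.map (@delzant_set R n) (g 0 :: L)).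
  by move=> P /List.in_map_iff[Q [<- _]]; exact: delzantP.
have hS0 : fan_refines S (g 0) by apply: hS; left.
have hSL Q : List.In Q L -> fan_refines S Q.
  by move=> QL; apply: hS; right; exact: List.in_map.
pose sigma (z : R * R) := clamp (2 * z.1).
pose delta (z : R * R) := clamp (2 * z.1 - 1).
pose tau (z : R * R) := clamp z.2.
pose kappa z := delta z * (1 - delta z) * (tau z * (1 - tau z)).
have delta01 z : 0 <= delta z <= 1 by exact: clamp01.
have tau01 z : 0 <= tau z <= 1 by exact: clamp01.
have prod01 (x : R) : 0 <= x <= 1 -> 0 <= x * (1 - x) <= 1.
  by move=> /andP[x0' x1']; apply/andP; split; nra.
have kappa01 z : 0 <= kappa z <= 1.
  have /andP[d0 d1] := prod01 _ (delta01 z); have /andP[t0 t1] := prod01 _ (tau01 z).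
  by rewrite /kappa mulr_ge0 //= mulr_ile1.
pose X z := mcomb (delta z) (G (sigma z, tau z)) (g 0).
pose F z := mcomb (kappa z) (X z) S.
have polS : polytope S by case: cS.
have polX z : polytope (X z) by apply: mcomb_polytope; exact: delzant_polytope.
have S0 : S !=set0 by case: polS.
have dF z : is_delzant (F z).
  rewrite /F; have [k0|k0] := eqVneq (kappa z) 0.
    rewrite k0 mcomb0 // /X.
    move/eqP: k0; rewrite !mulf_eq0 !subr_eq0.
    move=> /orP[/orP[/eqP ->|/eqP <-]|/orP[/eqP ->|/eqP <-]].
    - by rewrite (mcomb0 _ (delzant_neq0 _)); exact: delzantP.
    - by rewrite (mcomb1 _ (delzant_neq0 _)); exact: delzantP.
    - by rewrite side0 mcombxx //; [exact: delzantP|exact: delzant_polytope].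
    - by rewrite side1 mcombxx //; [exact: delzantP|exact: delzant_polytope].
  have s1 : sigma z = 1.
    apply: clamp_ge1; rewrite leNgt; apply/negP => lt; move: k0.
    by rewrite /kappa /delta clamp_le0 ?mul0r ?eqxx //; lra.
  rewrite mcombC; apply: charted_delzant; apply: fan_refines_mcomb_charted => //.
    have /andP[k1 k2] := kappa01 z; rewrite subr_ge0 k2 gtrBl.
    by rewrite lt_neqAle eq_sym k0.
  by rewrite /X s1; apply: fan_refines_mcomb => //; exact: Gend.
have cF : hausdorff_continuous F.
  apply: hausdorff_continuous_mcomb => //.
  - by rewrite /kappa /delta /tau; continuity.
  - apply: hausdorff_continuous_mcomb => //.
    + by rewrite /delta; continuity.
    + by move=> z; exact: delzant_polytope.
    + by move=> z; exact: delzant_polytope.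
    + apply: continuous_hausdorff => z.
      apply: (@continuous_comp _ _ _ (fun z => (sigma z, tau z)) G); last exact: cG.
      have cs : continuous sigma by rewrite /sigma; continuity.
      have ct : continuous tau by rewrite /tau; continuity.
      exact: cvg_pair (cs z) (ct z).
    + exact: hausdorff_continuous_cst.
  - exact: hausdorff_continuous_cst.
exists (fun z => to_delzant (g 0) (F z)); split.
- by apply: continuous_subspaceT; exact: to_delzant_continuous.
- move=> t; rewrite in_itv /= => t01; apply: to_delzant_set.
  have d0 : delta (0, t) = 0 by apply: clamp_le0 => /=; lra.
  have s0 : sigma (0, t) = 0 by apply: clamp_le0 => /=; lra.
  rewrite /F /kappa d0 !mul0r mcomb0 // /X d0 mcomb0; last exact: delzant_neq0.
  by rewrite s0 /tau /= clamp_id // G0 // clamp_closed_path.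
- move=> t; rewrite in_itv /= => t01; apply: to_delzant_set.
  have d1 : delta (1, t) = 1 by apply: clamp_ge1 => /=; lra.
  rewrite /F /kappa d1 subrr mulr0 mul0r mcomb0 // /X d1 mcomb1 //.
  exact: delzant_neq0.
- move=> s; rewrite in_itv /= => s01; split; apply: to_delzant_set.
    have t0 : tau (s, 0) = 0 by exact: clamp_le0.
    rewrite /F /kappa t0 mul0r mulr0 mcomb0 // /X t0 side0 mcombxx //.
    exact: delzant_polytope.
  have t1 : tau (s, 1) = 1 by exact: clamp_ge1.
  rewrite /F /kappa t1 subrr !mulr0 mcomb0 // /X t1 side1 mcombxx //.
  exact: delzant_polytope.
Qed.

Theorem theorem3p39 (R : realType) (n : nat) (g : R -> delzant R n) :
  is_loop g -> locally_refining g -> null_homotopic g.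
Proof.
move=> [gpath gloop] gref; apply: straightened_null_homotopic => //.
apply: straightened_unit_interval; first exact: continuous_clamped_path.
move=> t0 t01; have [|e e0 he] := gref t0; first by rewrite in_itv.
exists e => // t t01' tt0; rewrite !clamp_closed_path //.
apply: refines_fan_refines; first exact: delzantP.
by apply: he; rewrite ?in_itv.
Qed.
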